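(* Let $K$ be a class of structures in a finite relational language $L$. The following are equivalent: (1) $K\le_c PF$. (2) There is a c.e. set $\mathcal{S}$ of pairs $(\mathcal{A},n)$, with $\mathcal{A}$ a finite $L$-structure and $n\in\omega$, such that (a) for every $\mathcal{B}\in K$ there is $(\mathcal{A},n)\in\mathcal{S}$ with $\mathcal{A}\subseteq\mathcal{B}$; and (b) whenever $(\mathcal{A},n),(\mathcal{A}',n')\in\mathcal{S}$ and $\mathcal{B},\mathcal{B}'\in K$ with $\mathcal{A}\subseteq\mathcal{B}$ and $\mathcal{A}'\subseteq\mathcal{B}'$, we have $n=n'$ iff $\mathcal{B}\cong\mathcal{B}'$. (3) There is a c.e. set $\mathcal{S}^*$ of pairs $(\varphi,n)$, with $\varphi$ a finitary existential $L$-sentence and $n\in\omega$, such that (a) for every $\mathcal{B}\in K$ there is $(\varphi,n)\in\mathcal{S}^*$ with $\mathcal{B}\models\varphi$; and (b) whenever $(\varphi,n),(\varphi',n')\in\mathcal{S}^*$ and $\mathcal{B},\mathcal{B}'\in K$ with $\mathcal{B}\models\varphi$ and $\mathcal{B}'\models\varphi'$, we have $n=n'$ iff $\mathcal{B}\cong\mathcal{B}'$. (4) There is a computable sequence $(\varphi_n)_{n\in\omega}$ of computable $\Sigma_1$ $L$-sentences such that (a) every $\mathcal{B}\in K$ satisfies some $\varphi_n$; and (b) whenever $\mathcal{B},\mathcal{B}'\in K$ with $\mathcal{B}\models\varphi_n$ and $\mathcal{B}'\models\varphi_{n'}$, we have $\mathcal{B}\cong\mathcal{B}'$ iff $n=n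'$.
   Context: Conventions: every structure is for a finite relational language with universe a subset of $\omega$; a class is a collection of structures for one language closed under isomorphism. $\subseteq$ between structures denotes the substructure relation. $D(\mathcal{A})$ is the atomic diagram of $\mathcal{A}$. A computable transformation from $K$ to $K'$ is a c.e. set $\Phi$ of pairs $(\alpha,\varphi)$, $\alpha$ a finite subset of the atomic diagram of a finite structure in the language of $K$, $\varphi$ an atomic sentence or negation of one in the language of $K'$, such that for every $\mathcal{A}\in K$, $\{\varphi:(\exists\alpha\subseteq D(\mathcal{A}))(\alpha,\varphi)\in\Phi\}=D(\mathcal{B})$ for some $\mathcal{B}\in K'$. A computable embedding is a computable transformation with $\mathcal{A}\cong\mathcal{A}'\iff\Phi(\mathcal{A})\cong\Phi(\mathcal{A}')$; $K\le_c K'$ means one exists. $PF$ is the class of finite prime fields (in a relational language). A computable $\Sigma_1$ sentence is a c.e. (possibly infinite) disjunction of finitary existential sentences; a computable sequence of them is given by a computable sequence of c.e. indices. *)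

(* Defs.v *)
(* Computability theory developed from scratch:
   c.e. sets are projections of primitive recursive relations (Kleene normal form). *)
From mathcomp Require Import all_boot.
Set Implicit Arguments. Unset Strict Implicit. Unset Printing Implicit Defensive.

Inductive prf : Type :=
| PZero
| PSucc
| PProj of nat
| PComp of prf & seq prf
| PRec of prf & prf.

Fixpoint prf_eval (p : prf) (v : seq nat) {struct p} : nat :=
  match p with
  | PZero => 0
  | PSucc => (nth 0 v 0).+1
  | PProj i => nth 0 v i
  | PComp f gs => prf_eval f (map (fun g => prf_eval g v) gs)
  | PRec f g =>
      let fix r (n : nat) : nat :=
        match n with
        | 0 => prf_eval f (behead v)
        | n'.+1 => prf_eval g (n' :: r n' :: behead v)
        end in r (nth 0 v 0)
  end.

Definition ce (A : nat -> Prop) : Prop :=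
  exists p : prf, forall n, A n <-> exists m, prf_eval p [:: n; m] = 0.

(* c.e. set of objects of type T, via an (injective) Goedel coding. *)
Definition ce_pred (T : Type) (code : T -> nat) (P : T -> Prop) : Prop :=
  exists p : prf, forall x, P x <-> exists m, prf_eval p [:: code x; m] = 0.

(* uniformly c.e. sequence (W_n)_n of sets of objects: a computable sequence of c.e. indices *)
Definition ce_family (T : Type) (code : T -> nat) (W : nat -> T -> Prop) : Prop :=
  exists p : prf, forall n x, W n x <-> exists m, prf_eval p [:: n; code x; m] = 0.

Definition cpair (a b : nat) : nat := ((a + b) * (a + b).+1) %/ 2 + b.

Fixpoint code_seq (s : seq nat) : nat :=
  match s with
  | [::] => 0
  | x :: s' => (cpair x (code_seq s')).+1
  end.

Fixpoint In' (T : Type) (x : T) (s : seq T) : Prop :=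
  match s with
  | [::] => False
  | y :: s' => y = x \/ In' x s'
  end.

(* A finite relational language is given by the list [ar] of arities of its
   relation symbols R_0, ..., R_(size ar - 1). *)
Record structure := Structure {
  sdom : nat -> Prop;
  srel : nat -> seq nat -> Prop }.

Definition good_tuple (ar : seq nat) (A : structure) (i : nat) (t : seq nat) : Prop :=
  i < size ar /\ size t = nth 0 ar i /\ (forall x, In' x t -> sdom A x).

Definition iso (ar : seq nat) (A B : structure) : Prop :=
  exists f : nat -> nat,
    (forall x, sdom A x -> sdom B (f x)) /\
    (forall x y, sdom A x -> sdom A y -> f x = f y -> x = y) /\
    (forall y, sdom B y -> exists x, sdom A x /\ f x = y) /\
    (forall i t, good_tuple ar A i t -> (srel A i t <-> srel B i (map f t))).

Definition substr (ar : seq nat) (A B : structure) : Prop :=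
  (forall x, sdom A x -> sdom B x) /\
  (forall i t, good_tuple ar A i t -> (srel A i t <-> srel B i t)).

Definition iso_closed (ar : seq nat) (K : structure -> Prop) : Prop :=
  forall A B, iso ar A B -> K A -> K B.

Record finstr := FinStr {
  fdom : seq nat;
  ffacts : seq (nat * seq nat) }.

Definition fs (A : finstr) : structure :=
  {| sdom := fun x => x \in fdom A; srel := fun i t => (i, t) \in ffacts A |}.

Definition fin_wf (ar : seq nat) (A : finstr) : Prop :=
  forall i t, (i, t) \in ffacts A ->
    i < size ar /\ size t = nth 0 ar i /\ all (fun x => x \in fdom A) t.

Definition code_fs (A : finstr) : nat :=
  cpair (code_seq (fdom A))
        (code_seq (map (fun p => cpair p.1 (code_seq p.2)) (ffacts A))).

(* ---------- Atomic sentences with constants from omega; the atomic diagram ---------- *)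
Inductive atom : Type :=
| ARel of nat & seq nat
| AEq of nat & nat.

(* a literal (b, a): the atomic sentence a if b = true, its negation if b = false *)
Definition literal := (bool * atom)%type.

Definition code_atom (a : atom) : nat :=
  match a with
  | ARel i t => cpair 0 (cpair i (code_seq t))
  | AEq x y => cpair 1 (cpair x y)
  end.

Definition code_lit (l : literal) : nat := cpair (nat_of_bool l.1) (code_atom l.2).

Definition wf_lit (ar : seq nat) (l : literal) : Prop :=
  match l.2 with
  | ARel i t => i < size ar /\ size t = nth 0 ar i
  | AEq _ _ => True
  end.

Definition D (ar : seq nat) (A : structure) (l : literal) : Prop :=
  match l.2 with
  | ARel i t => good_tuple ar A i t /\ (if l.1 then srel A i t else ~ srel A i t)
  | AEq x y => sdom A x /\ sdom A y /\ (if l.1 then x = y else x <> y)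
  end.

Definition fin_diag_subset (ar : seq nat) (alpha : seq literal) : Prop :=
  exists C : finstr, fin_wf ar C /\ forall l, In' l alpha -> D ar (fs C) l.

Definition code_trans_pair (x : seq literal * literal) : nat :=
  cpair (code_seq (map code_lit x.1)) (code_lit x.2).

Definition Phi_app (ar : seq nat) (Phi : seq literal * literal -> Prop)
    (A : structure) (l : literal) : Prop :=
  exists alpha, (forall a, In' a alpha -> D ar A a) /\ Phi (alpha, l).

Definition comp_transformation (ar : seq nat) (K : structure -> Prop)
    (ar' : seq nat) (K' : structure -> Prop) (Phi : seq literal * literal -> Prop) : Prop :=
  ce_pred code_trans_pair Phi /\
  (forall alpha l, Phi (alpha, l) -> fin_diag_subset ar alpha /\ wf_lit ar' l) /\
  (forall A, K A -> exists B, K' B /\ forall l, Phi_app ar Phi A l <-> D ar' B l).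

Definition comp_embedding (ar : seq nat) (K : structure -> Prop)
    (ar' : seq nat) (K' : structure -> Prop) (Phi : seq literal * literal -> Prop) : Prop :=
  comp_transformation ar K ar' K' Phi /\
  (forall A A' B B', K A -> K A' ->
     (forall l, Phi_app ar Phi A l <-> D ar' B l) ->
     (forall l, Phi_app ar Phi A' l <-> D ar' B' l) ->
     (iso ar A A' <-> iso ar' B B')).

Definition comp_reducible (ar : seq nat) (K : structure -> Prop)
    (ar' : seq nat) (K' : structure -> Prop) : Prop :=
  exists Phi, comp_embedding ar K ar' K' Phi.

(* R_0 = graph of addition (ternary), R_1 = graph of multiplication (ternary) *)
Definition ar_field : seq nat := [:: 3; 3].

Definition Fp_struct (p : nat) : structure :=
  {| sdom := fun x => x < p;
     srel := fun i t => match t with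
                        | [:: a; b; c] =>
                            if i == 0 then (a + b) %% p = c
                            else if i == 1 then (a * b) %% p = c else False
                        | _ => False
                        end |}.

Definition PF (B : structure) : Prop :=
  exists p, prime p /\ iso ar_field (Fp_struct p) B.

(* quantifier-free formulas in variables x_0, x_1, ... *)
Inductive qf : Type :=
| QTrue
| QFalse
| QRel of nat & seq nat
| QEq of nat & nat
| QNot of qf
| QAnd of qf & qf
| QOr of qf & qf.

Fixpoint code_qf (f : qf) : nat :=
  match f with
  | QTrue => cpair 0 0
  | QFalse => cpair 1 0
  | QRel i vs => cpair 2 (cpair i (code_seq vs))
  | QEq x y => cpair 3 (cpair x y)
  | QNot g => cpair 4 (code_qf g)
  | QAnd g h => cpair 5 (cpair (code_qf g) (code_qf h))
  | QOr g h => cpair 6 (cpair (code_qf g) (code_qf h))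
  end.

Fixpoint wf_qf (ar : seq nat) (k : nat) (f : qf) : Prop :=
  match f with
  | QTrue | QFalse => True
  | QRel i vs => i < size ar /\ size vs = nth 0 ar i /\ all (fun j => j < k) vs
  | QEq x y => x < k /\ y < k
  | QNot g => wf_qf ar k g
  | QAnd g h | QOr g h => wf_qf ar k g /\ wf_qf ar k h
  end.

Fixpoint holds_qf (B : structure) (v : seq nat) (f : qf) : Prop :=
  match f with
  | QTrue => True
  | QFalse => False
  | QRel i vs => srel B i (map (fun j => nth 0 v j) vs)
  | QEq x y => nth 0 v x = nth 0 v y
  | QNot g => ~ holds_qf B v g
  | QAnd g h => holds_qf B v g /\ holds_qf B v h
  | QOr g h => holds_qf B v g \/ holds_qf B v h
  end.

(* the existential sentence  exists x_0 ... x_(nvars-1), matrix *)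
Record exsent := ExSent { nvars : nat; matrix : qf }.

Definition wf_ex (ar : seq nat) (e : exsent) : Prop := wf_qf ar (nvars e) (matrix e).

Definition code_ex (e : exsent) : nat := cpair (nvars e) (code_qf (matrix e)).

Definition sat_ex (B : structure) (e : exsent) : Prop :=
  exists v : seq nat, size v = nvars e /\ (forall x, In' x v -> sdom B x) /\
                      holds_qf B v (matrix e).

(* computable Sigma_1 sentence given by the c.e. set W of finitary existential
   sentences: the disjunction of W *)
Definition sat_sigma1 (B : structure) (W : exsent -> Prop) : Prop :=
  exists e, W e /\ sat_ex B e.

Definition cond1 (ar : seq nat) (K : structure -> Prop) : Prop :=
  comp_reducible ar K ar_field PF.

Definition cond2 (ar : seq nat) (K : structure -> Prop) : Prop :=
  exists S : finstr * nat -> Prop,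
    ce_pred (fun x => cpair (code_fs x.1) x.2) S /\
    (forall A n, S (A, n) -> fin_wf ar A) /\
    (forall B, K B -> exists A n, S (A, n) /\ substr ar (fs A) B) /\
    (forall A n A' n' B B', S (A, n) -> S (A', n') -> K B -> K B' ->
       substr ar (fs A) B -> substr ar (fs A') B' -> (n = n' <-> iso ar B B')).

Definition cond3 (ar : seq nat) (K : structure -> Prop) : Prop :=
  exists S : exsent * nat -> Prop,
    ce_pred (fun x => cpair (code_ex x.1) x.2) S /\
    (forall e n, S (e, n) -> wf_ex ar e) /\
    (forall B, K B -> exists e n, S (e, n) /\ sat_ex B e) /\
    (forall e n e' n' B B', S (e, n) -> S (e', n') -> K B -> K B' ->
       sat_ex B e -> sat_ex B' e' -> (n = n' <-> iso ar B B')).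

Definition cond4 (ar : seq nat) (K : structure -> Prop) : Prop :=
  exists phi : nat -> exsent -> Prop,
    ce_family code_ex phi /\
    (forall n e, phi n e -> wf_ex ar e) /\
    (forall B, K B -> exists n, sat_sigma1 B (phi n)) /\
    (forall n n' B B', K B -> K B' -> sat_sigma1 B (phi n) -> sat_sigma1 B' (phi n') ->
       (iso ar B B' <-> n = n')).

(* Main.v *)
(* Computably enumerable predicates on coded types are closed under conjunction, disjunction,
   existential quantification, bounded universal quantification and inductive generation; each
   of the translations between the four conditions is built from these operations.

   (1) => (2): the diagram of a prime field contains finitely many literals saying that some
   [c] is nonzero and [p * c = 0]; they determine the prime [p] and are produced by a finite
   substructure of the input.
   (2) => (3): a finite structure is described by an existential sentence whose variables are
   indexed by its elements. A model of the sentence contains a copy of the structure, and a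
   permutation of omega moves this copy onto the structure itself.
   (3) => (1): as soon as finitely many literals verify a sentence paired with [n], output the
   diagram of the prime field of the [n]-th prime.
   (3) <=> (4): both are c.e. sets of pairs. *)
Require Import Defs.
From mathcomp Require Import all_boot.
From mathcomp Require Import zify.
From Stdlib Require Import ClassicalEpsilon.
Set Implicit Arguments. Unset Strict Implicit. Unset Printing Implicit Defensive.

(** C.e. predicates are not closed under negation, so every negative or recursive ingredient is
    restated positively: falsity of a fact in a finite structure as being different from each listed
    fact, primality by explicit nonzero remainders, truth of a formula by derivations of both truth
    values, recursive functions by lists of their values. Searching through a coded type moreover
    requires its set of codes to be c.e., because a candidate found by the search is only a number.

    Why finitely many literals determine the prime: if [n] and [p] are prime and [n * c = 0] for
    some nonzero [c] of the field with [p] elements, then [p] divides [n], hence [n = p].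

    The sentence describing a finite structure must also state its negative facts, since a
    substructure reflects relations as well as preserving them. In (3) => (1) the output does not
    depend on which sentence is verified first: condition (b), applied to one structure twice,
    leaves a single [n]. *)

Lemma In'P (T : eqType) (x : T) s : In' x s <-> x \in s.
Proof.
elim: s => [|y s IH] //=; rewrite inE; split.
  by case=> [->|/IH ->]; rewrite ?eqxx ?orbT.
by case/orP=> [/eqP->|/IH]; [left|right].
Qed.

Lemma In'_cat T (x : T) s1 s2 : In' x (s1 ++ s2) <-> In' x s1 \/ In' x s2.
Proof. by elim: s1 => [|y s IH] /=; rewrite ?IH; tauto. Qed.

Lemma In'_map T U (f : T -> U) y s : In' y (map f s) <-> exists2 x, In' x s & f x = y.
Proof.
elim: s => [|z s IH] /=; first by split=> [|[]].
rewrite IH; split=> [[<-|[x xs <-]]|[x [->|xs] e]]; [by exists z; auto|by exists x; auto|by left|].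
by right; exists x.
Qed.

Lemma In'_drop T (x : T) s : In' x s <-> exists i s', drop i s = x :: s'.
Proof.
split.
  elim: s => [|y s IH] //= [->|/IH [i [s' e]]]; first by exists 0, s.
  by exists i.+1, s'.
case=> i [s' e]; elim: s i e => [|y s IH] [|i] //= => [[-> _]|/IH]; auto.
Qed.

(** * The pairing function *)

Definition tri (n : nat) : nat := (n * n.+1) %/ 2.

Lemma triS n : tri n.+1 = tri n + n.+1.
Proof.
rewrite /tri; have -> : n.+1 * n.+2 = n.+1 * 2 + n * n.+1 by nia.
by rewrite divnMDl // addnC.
Qed.

Lemma cpairE a b : cpair a b = tri (a + b) + b.
Proof. by []. Qed.

Lemma tri_homo m n : m <= n -> tri m <= tri n.
Proof.
elim: n => [|n IH]; first by rewrite leqn0 => /eqP->.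
by rewrite leq_eqVlt => /orP[/eqP-> //|/IH]; rewrite triS; lia.
Qed.

(** The largest [d] with [tri d <= c], that is, the antidiagonal containing [c]. The outer truncated
    difference is 1 exactly when [c] has reached the next triangular number, a form that transcribes
    directly into [PRec]. *)
Fixpoint diag (c : nat) : nat :=
  if c is c'.+1 then diag c' + (1 - (tri (diag c').+1 - c)) else 0.

Lemma diag_bound c : tri (diag c) <= c < tri (diag c).+1.
Proof.
elim: c => [|c IH] //.
rewrite [diag _]/=; set d := diag c in IH *.
have := triS d; have := triS d.+1.
case: (leqP (tri d.+1) c.+1) => h.
  have -> : d + (1 - (tri d.+1 - c.+1)) = d.+1 by lia.
  lia.
have -> : d + (1 - (tri d.+1 - c.+1)) = d by lia.
lia.
Qed.

Lemma diag_cpair a b : diag (cpair a b) = a + b.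
Proof.
have := diag_bound (cpair a b); rewrite cpairE; set d := diag _ => /andP[h1 h2].
have := triS (a + b) => h3.
apply/eqP; rewrite eqn_leq; apply/andP; split; rewrite leqNgt; apply/negP => h.
  by have := tri_homo h; lia.
by have := tri_homo h; lia.
Qed.

Definition unp2 (c : nat) : nat := c - tri (diag c).
Definition unp1 (c : nat) : nat := diag c - unp2 c.

Lemma unp2K a b : unp2 (cpair a b) = b.
Proof. by rewrite /unp2 diag_cpair cpairE addKn. Qed.

Lemma unp1K a b : unp1 (cpair a b) = a.
Proof. by rewrite /unp1 unp2K diag_cpair addnK. Qed.

Lemma unpK c : cpair (unp1 c) (unp2 c) = c.
Proof.
have := diag_bound c; rewrite triS => h.
have e : unp1 c + unp2 c = diag c by rewrite /unp1 /unp2; lia.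
by rewrite cpairE e /unp2; lia.
Qed.

Lemma cpair_inj a b a' b' : cpair a b = cpair a' b' -> a = a' /\ b = b'.
Proof. by move=> e; rewrite -(unp1K a b) -{2}(unp2K a b) e unp1K unp2K. Qed.

Lemma leq_unp2 c : unp2 c <= c.
Proof. exact: leq_subr. Qed.

Lemma code_seq_inj : injective code_seq.
Proof. by elim=> [|x s IH] [|y t] //= [/cpair_inj[-> /IH ->]]. Qed.

Lemma code_seq_surj c : exists s, code_seq s = c.
Proof.
elim/ltn_ind: c => -[_|c IH]; first by exists [::].
have [s e] := IH (unp2 c) (leq_ltn_trans (leq_unp2 c) (ltnSn c)).
by exists (unp1 c :: s); rewrite /= e unpK.
Qed.

(** This makes positions in a list a bounded search: every position lies below the code, which
    programs receive as an argument. *)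
Lemma size_code_seq s : size s <= code_seq s.
Proof. by elim: s => //= x s IH; rewrite cpairE; lia. Qed.

(** Both [hdc] and [tlc] send 0, the code of the empty list, to 0, so iterating past the end is
    harmless and reading there yields the default 0. *)
Definition hdc (c : nat) : nat := unp1 c.-1.
Definition tlc (c : nat) : nat := unp2 c.-1.

Lemma iter_tlc i s : iter i tlc (code_seq s) = code_seq (drop i s).
Proof.
elim: i s => [|i IH] s; first by rewrite drop0.
have e : tlc (code_seq s) = code_seq (behead s).
  by case: s => [|x s] //; rewrite /tlc /= unp2K.
by rewrite iterSr e IH; case: s {e}; rewrite ?drop_nil.
Qed.

Lemma hdc_code s : hdc (code_seq s) = head 0 s.
Proof. by case: s => [|x s] //; rewrite /hdc /= unp1K. Qed.

(** * Primitive recursive programs *)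

Definition rep1 (h : nat -> nat) := exists p, forall a, prf_eval p [:: a] = h a.
Definition rep2 (h : nat -> nat -> nat) := exists p, forall a b, prf_eval p [:: a; b] = h a b.

Definition p_add := PRec (PProj 0) (PComp PSucc [:: PProj 1]).
Lemma p_addE a b s : prf_eval p_add [:: a, b & s] = a + b.
Proof. by elim: a => //= a ->. Qed.

Definition p_mul := PRec PZero (PComp p_add [:: PProj 2; PProj 1]).
Lemma p_mulE a b s : prf_eval p_mul [:: a, b & s] = a * b.
Proof. by elim: a => // a IH; rewrite mulSn -IH -(p_addE _ _ [::]). Qed.

Definition p_pred := PRec PZero (PProj 0).
Lemma p_predE a s : prf_eval p_pred (a :: s) = a.-1.
Proof. by case: a. Qed.

Definition p_sub := PComp (PRec (PProj 0) (PComp p_pred [:: PProj 1])) [:: PProj 1; PProj 0].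
Lemma p_subE a b s : prf_eval p_sub [:: a, b & s] = a - b.
Proof. by rewrite /=; elim: b => [|b /= ->]; rewrite ?subn0 // subnS; case: (a - b). Qed.

Definition p_tri := PRec PZero (PComp p_add [:: PProj 1; PComp PSucc [:: PProj 0]]).
Lemma p_triE a s : prf_eval p_tri (a :: s) = tri a.
Proof. by elim: a => // a IH; rewrite triS -IH -(p_addE _ _ [::]). Qed.

Definition p_pair :=
  PComp p_add [:: PComp p_tri [:: PComp p_add [:: PProj 0; PProj 1]]; PProj 1].
Lemma p_pairE a b s : prf_eval p_pair [:: a, b & s] = cpair a b.
Proof. by rewrite cpairE -(p_addE a b [::]) -(p_triE _ [::]) -(p_addE _ b [::]). Qed.

Definition p_diag :=
  PRec PZero (PComp p_add [:: PProj 1; PComp p_sub [:: PComp PSucc [:: PZero];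
    PComp p_sub [:: PComp p_tri [:: PComp PSucc [:: PProj 1]]; PComp PSucc [:: PProj 0]]]]).
Lemma p_diagE c s : prf_eval p_diag (c :: s) = diag c.
Proof.
elim: c => // c IH; rewrite /= -IH -(p_triE _ [::]) -(p_subE _ c.+1 [::]) -(p_subE 1 _ [::]).
by rewrite -(p_addE _ _ [::]).
Qed.

Definition p_unp2 := PComp p_sub [:: PProj 0; PComp p_tri [:: p_diag]].
Lemma p_unp2E c s : prf_eval p_unp2 (c :: s) = unp2 c.
Proof. by rewrite /unp2 -(p_diagE c s) -(p_triE _ [::]) -(p_subE c _ [::]). Qed.

Definition p_unp1 := PComp p_sub [:: p_diag; p_unp2].
Lemma p_unp1E c s : prf_eval p_unp1 (c :: s) = unp1 c.
Proof. by rewrite /unp1 -(p_unp2E c s) -(p_diagE c s) -(p_subE _ _ [::]). Qed.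

Definition p_iter_tl := PRec (PProj 0) (PComp p_unp2 [:: PComp p_pred [:: PProj 1]]).
Lemma p_iter_tlE i c s : prf_eval p_iter_tl [:: i, c & s] = iter i tlc c.
Proof. by elim: i => // i IH; rewrite iterS -IH {1}/tlc -(p_predE _ [::]) -(p_unp2E _ [::]). Qed.

Definition p_hd := PComp p_unp1 [:: PComp p_pred [:: PProj 0]].
Lemma p_hdE c s : prf_eval p_hd (c :: s) = hdc c.
Proof. by rewrite /hdc -(p_predE c [::]) -(p_unp1E _ [::]). Qed.

(** Counts the positions below the code at which the remaining list is still nonempty; [1 - (1 - z)]
    is the sign of [z]. The code is passed twice, as the number of rounds and as the list. *)
Definition p_size :=
  PComp (PRec PZero (PComp p_add [:: PProj 1; PComp p_sub [:: PComp PSucc [:: PZero];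
    PComp p_sub [:: PComp PSucc [:: PZero]; PComp p_iter_tl [:: PProj 0; PProj 2]]]]))
  [:: PProj 0; PProj 0].
Lemma p_sizeE s : prf_eval p_size [:: code_seq s] = size s.
Proof.
have -> : size s = minn (code_seq s) (size s) by apply/esym/minn_idPr/size_code_seq.
set c := {2}(code_seq s).
suff H n : prf_eval (PRec PZero (PComp p_add [:: PProj 1; PComp p_sub [:: PComp PSucc [:: PZero];
    PComp p_sub [:: PComp PSucc [:: PZero]; PComp p_iter_tl [:: PProj 0; PProj 2]]]]))
  [:: n; code_seq s] = minn n (size s) by rewrite -H.
elim: n => [|n IH]; first by rewrite min0n.
transitivity (prf_eval p_add [:: minn n (size s);
  prf_eval p_sub [:: 1; prf_eval p_sub [:: 1; prf_eval p_iter_tl [:: n; code_seq s]]]]).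
  by rewrite -IH.
rewrite p_addE !p_subE p_iter_tlE iter_tlc.
have := size_drop n s; case: (drop n s) => [|x t] /= h; lia.
Qed.

(** * Coded types, primitive recursive functions and c.e. predicates *)

(** [code_range] is what existential quantification over [T] consumes: a program can only guess a
    number, and has to verify that it codes an element. The instances are transparent so that [code]
    computes to the concrete codings of the definitions. *)
Class Coded (T : Type) := {
  code : T -> nat;
  code_inj : injective code;
  code_range : exists p, forall c, (exists x, code x = c) <-> exists m, prf_eval p [:: c; m] = 0 }.

Definition PR T U `{Coded T} `{Coded U} (f : T -> U) :=
  exists p, forall x, prf_eval p [:: code x] = code (f x).

Definition CE T `{Coded T} (P : T -> Prop) := ce_pred code P.

#[export] Instance Coded_nat : Coded nat.
Proof.
exists id => //; exists PZero => c; split=> _; [by exists 0|by exists c].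
Defined.

#[export] Instance Coded_prod T U (cT : Coded T) (cU : Coded U) : Coded (T * U).
Proof.
exists (fun x => cpair (code x.1) (code x.2)).
  by case=> a b [c d] /= /cpair_inj[/(@code_inj _ cT) -> /(@code_inj _ cU) ->].
have [p Hp] := @code_range T cT; have [q Hq] := @code_range U cU.
(* A sum vanishes iff both summands do, and one witness packs the two by pairing. Conjunctions are
   handled in the same way. *)
exists (PComp p_add [:: PComp p [:: PComp p_unp1 [:: PProj 0]; PComp p_unp1 [:: PProj 1]];
                        PComp q [:: PComp p_unp2 [:: PProj 0]; PComp p_unp2 [:: PProj 1]]]).
have E c m : prf_eval (PComp p_add [:: PComp p [:: PComp p_unp1 [:: PProj 0]; PComp p_unp1 [:: PProj 1]];
                        PComp q [:: PComp p_unp2 [:: PProj 0]; PComp p_unp2 [:: PProj 1]]]) [:: c; m]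
  = prf_eval p [:: unp1 c; unp1 m] + prf_eval q [:: unp2 c; unp2 m].
  by rewrite -!(p_unp1E _ [::]) -!(p_unp2E _ [::]) -(p_addE _ _ [::]).
move=> c; split.
  case=> -[x y] <-.
  have [m1 h1] : exists m, prf_eval p [:: code x; m] = 0 by apply/Hp; exists x.
  have [m2 h2] : exists m, prf_eval q [:: code y; m] = 0 by apply/Hq; exists y.
  by exists (cpair m1 m2); rewrite E !unp1K !unp2K h1.
case=> m; rewrite E => /eqP; rewrite addn_eq0 => /andP[/eqP h1 /eqP h2].
have [x ex] : exists x : T, code x = unp1 c by apply/Hp; exists (unp1 m).
have [y ey] : exists y : U, code y = unp2 c by apply/Hq; exists (unp2 m).
by exists (x, y); rewrite /= ex ey unpK.
Defined.

Lemma PR_comp T U V `{Coded T} `{Coded U} `{Coded V} (g : U -> V) (f : T -> U) :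
  PR g -> PR f -> PR (fun x => g (f x)).
Proof. by case=> p Hp [q Hq]; exists (PComp p [:: q]) => x; rewrite /= Hq Hp. Qed.

Lemma PR_id T `{Coded T} : PR (fun x : T => x).
Proof. by exists (PProj 0). Qed.

Lemma PR_const T U `{Coded T} `{Coded U} (y : U) : PR (fun _ : T => y).
Proof.
suff H1 n : exists p, forall v, prf_eval p v = n.
  by have [p Hp] := H1 (code y); exists p.
elim: n => [|n [p Hp]]; first by exists PZero.
by exists (PComp PSucc [:: p]) => v /=; rewrite Hp.
Qed.

Lemma PR_rep1 T `{Coded T} (h : nat -> nat) (f : T -> nat) :
  rep1 h -> PR f -> PR (fun x => h (f x)).
Proof. by case=> p Hp [q Hq]; exists (PComp p [:: q]) => x; rewrite /= Hq Hp. Qed.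

Lemma PR_rep2 T `{Coded T} (h : nat -> nat -> nat) (f g : T -> nat) :
  rep2 h -> PR f -> PR g -> PR (fun x => h (f x) (g x)).
Proof.
by case=> p Hp [q Hq] [r Hr]; exists (PComp p [:: q; r]) => x; rewrite /= Hq Hr Hp.
Qed.

Lemma PR_code T U `{Coded T} `{Coded U} (f : T -> U) :
  PR f <-> PR (fun x => code (f x)).
Proof. by split. Qed.

Lemma PR_S T `{Coded T} (f : T -> nat) : PR f -> PR (fun x => (f x).+1).
Proof. by apply: PR_rep1; exists PSucc. Qed.

Lemma PR_add T `{Coded T} (f g : T -> nat) : PR f -> PR g -> PR (fun x => f x + g x).
Proof. by apply: PR_rep2; exists p_add => a b; rewrite p_addE. Qed.

Lemma PR_mul T `{Coded T} (f g : T -> nat) : PR f -> PR g -> PR (fun x => f x * g x).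
Proof. by apply: PR_rep2; exists p_mul => a b; rewrite p_mulE. Qed.

Lemma PR_sub T `{Coded T} (f g : T -> nat) : PR f -> PR g -> PR (fun x => f x - g x).
Proof. by apply: PR_rep2; exists p_sub => a b; rewrite p_subE. Qed.

Lemma PR_cpair T `{Coded T} (f g : T -> nat) : PR f -> PR g -> PR (fun x => cpair (f x) (g x)).
Proof. by apply: PR_rep2; exists p_pair => a b; rewrite p_pairE. Qed.

Lemma PR_unp1 T `{Coded T} (f : T -> nat) : PR f -> PR (fun x => unp1 (f x)).
Proof. by apply: PR_rep1; exists p_unp1 => a; rewrite p_unp1E. Qed.

Lemma PR_unp2 T `{Coded T} (f : T -> nat) : PR f -> PR (fun x => unp2 (f x)).
Proof. by apply: PR_rep1; exists p_unp2 => a; rewrite p_unp2E. Qed.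

Lemma PR_hdc T `{Coded T} (f : T -> nat) : PR f -> PR (fun x => hdc (f x)).
Proof. by apply: PR_rep1; exists p_hd => a; rewrite p_hdE. Qed.

Lemma PR_iter_tlc T `{Coded T} (f g : T -> nat) :
  PR f -> PR g -> PR (fun x => iter (f x) tlc (g x)).
Proof. by apply: (@PR_rep2 _ _ (fun i c => iter i tlc c)); exists p_iter_tl => a b; rewrite p_iter_tlE. Qed.

Lemma PR_codeT T U `{Coded T} `{Coded U} (f : T -> U) : PR f -> PR (fun x => code (f x)).
Proof. by []. Qed.

Lemma PR_ext T U `{Coded T} `{Coded U} (f g : T -> U) : (forall x, f x = g x) -> PR f -> PR g.
Proof. by move=> e [p Hp]; exists p => x; rewrite Hp e. Qed.

Lemma PR_pair T U V `{Coded T} `{Coded U} `{Coded V} (f : T -> U) (g : T -> V) :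
  PR f -> PR g -> PR (fun x => (f x, g x)).
Proof. by move=> hf hg; apply/PR_code/(PR_cpair (f := fun x => code (f x)) (g := fun x => code (g x))). Qed.

Lemma PR_fst T U V `{Coded T} `{Coded U} `{Coded V} (f : T -> U * V) :
  PR f -> PR (fun x => (f x).1).
Proof.
move=> hf; apply/PR_code; apply: PR_ext (PR_unp1 (f := fun x => code (f x)) hf) => x.
exact: unp1K.
Qed.

Lemma PR_snd T U V `{Coded T} `{Coded U} `{Coded V} (f : T -> U * V) :
  PR f -> PR (fun x => (f x).2).
Proof.
move=> hf; apply/PR_code; apply: PR_ext (PR_unp2 (f := fun x => code (f x)) hf) => x.
exact: unp2K.
Qed.

(** * Closure properties of c.e. predicates *)

Lemma CE_ext T `{Coded T} (P Q : T -> Prop) : (forall x, P x <-> Q x) -> CE P -> CE Q.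
Proof. by move=> e [p Hp]; exists p => x; rewrite -e. Qed.

Lemma CE_subst T U `{Coded T} `{Coded U} (P : U -> Prop) (f : T -> U) :
  CE P -> PR f -> CE (fun x => P (f x)).
Proof.
case=> p Hp [q Hq]; exists (PComp p [:: PComp q [:: PProj 0]; PProj 1]) => x.
by rewrite /= Hq; apply: Hp.
Qed.

Lemma CE_eq0 T `{Coded T} (f : T -> nat) : PR f -> CE (fun x => f x = 0).
Proof.
case=> p Hp; exists (PComp p [:: PProj 0]) => x.
by rewrite /= Hp; split=> [e|[]//]; exists 0.
Qed.

Lemma CE_True T `{Coded T} : CE (fun _ : T => True).
Proof. by exists PZero => x; split=> // _; exists 0. Qed.

Lemma CE_and T `{Coded T} (P Q : T -> Prop) : CE P -> CE Q -> CE (fun x => P x /\ Q x).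
Proof.
case=> p Hp [q Hq].
exists (PComp p_add [:: PComp p [:: PProj 0; PComp p_unp1 [:: PProj 1]];
                        PComp q [:: PProj 0; PComp p_unp2 [:: PProj 1]]]) => x.
have E m : prf_eval (PComp p_add [:: PComp p [:: PProj 0; PComp p_unp1 [:: PProj 1]];
                        PComp q [:: PProj 0; PComp p_unp2 [:: PProj 1]]]) [:: code x; m]
  = prf_eval p [:: code x; unp1 m] + prf_eval q [:: code x; unp2 m].
  by rewrite -(p_unp1E _ [::]) -(p_unp2E _ [::]) -(p_addE _ _ [::]).
split=> [[/Hp[m h] /Hq[n k]]|[m]].
  by exists (cpair m n); rewrite E unp1K unp2K h k.
rewrite E => /eqP; rewrite addn_eq0 => /andP[/eqP h1 /eqP h2]; split.
  by apply/Hp; exists (unp1 m).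
by apply/Hq; exists (unp2 m).
Qed.

Lemma CE_or T `{Coded T} (P Q : T -> Prop) : CE P -> CE Q -> CE (fun x => P x \/ Q x).
Proof.
case=> p Hp [q Hq]; exists (PComp p_mul [:: p; q]) => x.
have E m : prf_eval (PComp p_mul [:: p; q]) [:: code x; m]
  = prf_eval p [:: code x; m] * prf_eval q [:: code x; m].
  by rewrite -(p_mulE _ _ [::]).
split=> [[/Hp|/Hq] [m h]|[m]]; [by exists m; rewrite E h|by exists m; rewrite E h muln0|].
by rewrite E => /eqP; rewrite muln_eq0 => /orP[] /eqP h; [left; apply/Hp|right; apply/Hq]; exists m.
Qed.

(** The witness packs three numbers: a candidate code of [y], a witness that it is a code, and a
    witness for [P x y]. *)
Lemma CE_ex T U `{Coded T} `{Coded U} (P : T -> U -> Prop) :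
  CE (fun z : T * U => P z.1 z.2) -> CE (fun x => exists y, P x y).
Proof.
case=> p Hp; have [r Hr] := @code_range U _.
pose P1 := PComp r [:: PComp p_unp1 [:: PProj 1];
                       PComp p_unp1 [:: PComp p_unp2 [:: PProj 1]]].
pose P2 := PComp p [:: PComp p_pair [:: PProj 0; PComp p_unp1 [:: PProj 1]];
                       PComp p_unp2 [:: PComp p_unp2 [:: PProj 1]]].
exists (PComp p_add [:: P1; P2]) => x.
have E m : prf_eval (PComp p_add [:: P1; P2]) [:: code x; m] =
  prf_eval r [:: unp1 m; unp1 (unp2 m)] +
  prf_eval p [:: cpair (code x) (unp1 m); unp2 (unp2 m)].
  rewrite -(p_unp1E m [::]) -(p_unp2E m [::]) -(p_unp1E (prf_eval p_unp2 _) [::]).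
  by rewrite -(p_unp2E (prf_eval p_unp2 _) [::]) -(p_pairE _ _ [::]) -(p_addE _ _ [::]).
split=> [[y /(Hp (x, y)) [m h]]|[m]].
  have [n k] : exists m, prf_eval r [:: code y; m] = 0 by apply/Hr; exists y.
  by exists (cpair (code y) (cpair n m)); rewrite E !(unp1K, unp2K) k h.
rewrite E => /eqP; rewrite addn_eq0 => /andP[/eqP h1 /eqP h2].
have [y ey] : exists y : U, code y = unp1 m by apply/Hr; exists (unp1 (unp2 m)).
by exists y; apply/(Hp (x, y)); exists (unp2 (unp2 m)); rewrite /= ey.
Qed.

Lemma finite_choice (R : nat -> nat -> Prop) n :
  (forall i, i < n -> exists m, R i m) -> exists s, forall i, i < n -> R i (nth 0 s i).
Proof.
elim: n => [|n IH] h; first by exists [::].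
have [s hs] := IH (fun i l => h i (ltnW l)); have [m hm] := h n (ltnSn n).
exists (mkseq (fun i => if i == n then m else nth 0 s i) n.+1) => i l.
rewrite nth_mkseq //; case: eqP => [->//|ne]; apply: hs; lia.
Qed.

Lemma CE_allb T `{Coded T} (P : T -> nat -> Prop) (n : T -> nat) :
  PR n -> CE (fun z : T * nat => P z.1 z.2) -> CE (fun x => forall i, i < n x -> P x i).
Proof.
case=> q Hq [p Hp].
(* A single witness is the code of the list of the witnesses for all [i < n x]. *)
pose Q := PComp p [:: PComp p_pair [:: PProj 2; PProj 0];
                      PComp p_hd [:: PComp p_iter_tl [:: PProj 0; PProj 3]]].
pose L := PRec PZero (PComp p_add [:: PProj 1; Q]).
have E k c w : prf_eval L [:: k; c; w] =
    \sum_(i < k) prf_eval p [:: cpair c i; hdc (iter i tlc w)].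
  elim: k => [|k IH]; first by rewrite big_ord0.
  rewrite big_ord_recr /= -IH -(p_iter_tlE _ _ [::]) -(p_hdE _ [::]) -(p_pairE _ _ [::]).
  by rewrite -(p_addE _ _ [::]).
exists (PComp L [:: PComp q [:: PProj 0]; PProj 0; PProj 1]) => x.
have {}E m : prf_eval (PComp L [:: PComp q [:: PProj 0]; PProj 0; PProj 1]) [:: code x; m] = 0 <->
    forall i, i < n x -> prf_eval p [:: cpair (code x) i; hdc (iter i tlc m)] = 0.
  have -> : prf_eval (PComp L [:: PComp q [:: PProj 0]; PProj 0; PProj 1]) [:: code x; m] =
    prf_eval L [:: n x; code x; m] by rewrite -[n x](Hq x).
  rewrite E; split=> [/eqP|h]; last by apply: big1 => i _; apply: h.
  by rewrite sum_nat_eq0 => /forallP h i l; have /= /eqP := h (Ordinal l).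
split=> [h|[m /E h] i l]; last by apply/(Hp (x, i)); exists (hdc (iter i tlc m)); apply: h.
have [i l|s hs] := @finite_choice (fun i m => prf_eval p [:: cpair (code x) i; m] = 0) (n x).
  by apply/(Hp (x, i))/h.
exists (code_seq s); apply/E => i l.
by rewrite iter_tlc hdc_code -nth0 nth_drop addn0; apply: hs.
Qed.

Lemma code_eqE T `{Coded T} (x y : T) : (x = y) <-> (code x - code y) + (code y - code x) = 0.
Proof. by split=> [->|e]; [rewrite subnn|apply: code_inj; lia]. Qed.

Lemma CE_eq T U `{Coded T} `{Coded U} (f g : T -> U) : PR f -> PR g -> CE (fun x => f x = g x).
Proof.
move=> /PR_code hf /PR_code hg; apply: CE_ext (fun x => iff_sym (code_eqE (f x) (g x))) _.
by apply/CE_eq0/PR_add; apply: PR_sub.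
Qed.

Lemma CE_neq T U `{Coded T} `{Coded U} (f g : T -> U) : PR f -> PR g -> CE (fun x => f x <> g x).
Proof.
move=> /PR_code hf /PR_code hg.
apply: (@CE_ext _ _ (fun x => 1 - ((code (f x) - code (g x)) + (code (g x) - code (f x))) = 0)).
  move=> x; rewrite (code_eqE (f x) (g x)).
  lia.
by apply/CE_eq0/PR_sub; [apply: PR_const|apply: PR_add; apply: PR_sub].
Qed.

Lemma CE_leq T `{Coded T} (f g : T -> nat) : PR f -> PR g -> CE (fun x => f x <= g x).
Proof.
move=> hf hg; apply: (@CE_ext _ _ (fun x => f x - g x = 0)); first by move=> x; split=> /eqP.
by apply/CE_eq0/PR_sub.
Qed.

(** Every number codes a list of numbers, so recognising codes of lists over [T] only requires each
    entry to be a code. Positions beyond the end are recognised by [iter i tlc c = 0]. *)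
#[export] Instance Coded_seq T (cT : Coded T) : Coded (seq T).
Proof.
exists (fun s => code_seq (map code s)).
  by apply: inj_comp; [exact: code_seq_inj|apply: inj_map; exact: code_inj].
have [r Hr] := @code_range T cT.
have [p Hp] : CE (fun c : nat => forall i, i < c ->
    iter i tlc c = 0 \/ exists m, prf_eval r [:: hdc (iter i tlc c); m] = 0).
  apply: CE_allb; first exact: PR_id.
  have hi : PR (fun z : nat * nat => iter z.2 tlc z.1).
    by apply: PR_iter_tlc; [apply: PR_snd|apply: PR_fst]; apply: PR_id.
  apply: CE_or; first exact: CE_eq0.
  apply: (CE_subst (P := fun c : nat => exists m, prf_eval r [:: c; m] = 0)); last exact: PR_hdc.
  by exists r.
exists p => c; rewrite -Hp {p Hp}.
have [t <-] := code_seq_surj c.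
transitivity (forall y, In' y t -> exists x : T, @code T cT x = y).
  split.
    by case=> s /code_seq_inj <- y /In'_map [x _ <-]; exists x.
  move=> h; suff [s e] : exists s : seq T, map (@code T cT) s = t by exists s; rewrite e.
  elim: t h => [|y t IH] h; first by exists [::].
  have [|s es] := IH; first by move=> z hz; apply: h; right.
  have [x ex] := h y (or_introl erefl).
  by exists (x :: s); rewrite /= ex es.
split=> h.
  move=> i _; rewrite iter_tlc hdc_code.
  case e : (drop i t) => [|y u]; [by left|right; apply/Hr/h/In'_drop; by exists i, u].
move=> y /In'_drop [i [u e]].
have l : i < code_seq t.
  by apply: leq_trans (size_code_seq t); rewrite ltnNge; apply/negP => /drop_oversize; rewrite e.
by case: (h i l); rewrite iter_tlc e // hdc_code => /Hr.
Defined.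

Lemma PR_cons T U `{Coded T} `{Coded U} (f : T -> U) (g : T -> seq U) :
  PR f -> PR g -> PR (fun x => f x :: g x).
Proof.
by move=> /PR_code hf /PR_code hg; apply/PR_code; apply: PR_S; apply: PR_cpair hf hg.
Qed.

Lemma PR_drop T U `{Coded T} `{Coded U} (f : T -> nat) (g : T -> seq U) :
  PR f -> PR g -> PR (fun x => drop (f x) (g x)).
Proof.
move=> hf hg; apply/PR_code; apply: PR_ext (PR_iter_tlc hf (PR_codeT hg)) => x.
by rewrite /= iter_tlc map_drop.
Qed.

Lemma PR_nth T `{Coded T} (f : T -> nat) (g : T -> seq nat) :
  PR f -> PR g -> PR (fun x => nth 0 (g x) (f x)).
Proof.
move=> hf hg; apply: PR_ext (PR_hdc (PR_iter_tlc hf (PR_codeT hg))) => x.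
by rewrite /= iter_tlc hdc_code map_id -nth0 nth_drop addn0.
Qed.

Lemma PR_size T U `{Coded T} `{Coded U} (f : T -> seq U) : PR f -> PR (fun x => size (f x)).
Proof.
case=> p Hp; exists (PComp p_size [:: p]) => x.
rewrite -[code (size _)](size_map code) -p_sizeE -[code_seq _](Hp x); by [].
Qed.

Lemma CE_In T U `{Coded T} `{Coded U} (f : T -> U) (g : T -> seq U) :
  PR f -> PR g -> CE (fun x => In' (f x) (g x)).
Proof.
move=> hf hg.
apply: (@CE_ext _ _ (fun x => exists i s', drop i (g x) = f x :: s')).
  by move=> x; rewrite In'_drop.
do 2!apply: CE_ex; apply: CE_eq; [apply: PR_drop|apply: PR_cons].
- exact/PR_snd/PR_fst/PR_id.
- exact/(PR_comp hg)/PR_fst/PR_fst/PR_id.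
- exact/(PR_comp hf)/PR_fst/PR_fst/PR_id.
- exact/PR_snd/PR_id.
Qed.

Lemma In'_code T `{Coded T} (x : T) s i s' : drop i s = x :: s' -> i < code s.
Proof.
move=> e; apply: leq_trans (size_code_seq (map code s)); rewrite size_map ltnNge.
by apply/negP => /drop_oversize; rewrite e.
Qed.

(** The suffix behind the entry is handed to [P] for the sake of derivations, in which an item is
    justified by those behind it. *)
Lemma CE_all_drop T U `{Coded T} `{Coded U} (P : T -> seq U -> U -> Prop) (s : T -> seq U) :
  PR s -> CE (fun z : T * seq U * U => P z.1.1 z.1.2 z.2) ->
  CE (fun x => forall i y s', drop i (s x) = y :: s' -> P x s' y).
Proof.
move=> hs hP.
apply: (@CE_ext _ _ (fun x => forall i, i < code (s x) -> drop i (s x) = [::] \/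
    exists y s', drop i (s x) = y :: s' /\ P x s' y)).
  move=> x; split=> [h i y s' e|h i l].
    by have [|[z [t [e' ht]]]] := h i (In'_code e); [rewrite e|move: e'; rewrite e => -[-> ->]].
  by case e: (drop i (s x)) => [|y s']; [left|right; exists y, s'; split=> //; apply: h e].
have d1 : PR (fun z : T * nat => drop z.2 (s z.1)).
  by apply: PR_drop; [apply/PR_snd/PR_id|apply/(PR_comp hs)/PR_fst/PR_id].
apply: CE_allb => //; apply: CE_or; first by apply: CE_eq => //; apply: PR_const.
do 2!apply: CE_ex; apply: CE_and.
  apply: CE_eq; first by apply: (PR_comp d1); apply/PR_fst/PR_fst/PR_id.
  by apply: PR_cons; [apply/PR_snd/PR_fst/PR_id|apply/PR_snd/PR_id].
apply: (CE_subst (f := fun z : T * nat * U * seq U => (z.1.1.1, z.2, z.1.2)) hP).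
apply: PR_pair; first apply: PR_pair.
- exact/PR_fst/PR_fst/PR_fst/PR_id.
- exact/PR_snd/PR_id.
- exact/PR_snd/PR_fst/PR_id.
Qed.

Lemma CE_all_In T U `{Coded T} `{Coded U} (P : T -> U -> Prop) (s : T -> seq U) :
  PR s -> CE (fun z : T * U => P z.1 z.2) -> CE (fun x => forall y, In' y (s x) -> P x y).
Proof.
move=> hs hP.
apply: (@CE_ext _ _ (fun x => forall i y s', drop i (s x) = y :: s' -> P x y)).
  move=> x; split=> [h y /In'_drop[i [s' e]]|h i y s' e]; first exact: h e.
  by apply: h; apply/In'_drop; exists i, s'.
apply: (CE_all_drop (P := fun x _ y => P x y)) => //.
apply: (CE_subst (f := fun z : T * seq U * U => (z.1.1, z.2)) hP).
by apply: PR_pair; [apply/PR_fst/PR_fst/PR_id|apply/PR_snd/PR_id].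
Qed.

(* A derivation lists, from last to first, items each of which follows by [Step] from earlier ones. *)
Fixpoint derivation (C T : Type) (Step : C -> seq T -> T -> Prop) (c : C) (s : seq T) : Prop :=
  if s is x :: s' then Step c s' x /\ derivation Step c s' else True.

Definition derivable C T (Step : C -> seq T -> T -> Prop) c x :=
  exists s, derivation Step c s /\ In' x s.

Lemma derivation_drop C T (Step : C -> seq T -> T -> Prop) c s :
  derivation Step c s <-> forall i x s', drop i s = x :: s' -> Step c s' x.
Proof.
elim: s => [|y s IH] //=; rewrite IH; split.
  by case=> h1 h2 [|i] x s' /=; [case=> <- <-|apply: h2].
by move=> h; split=> [|i x s' e]; [apply: (h 0)|apply: (h i.+1)].
Qed.

(** Being a derivation is a recursion over a list; [derivation_drop] replaces it by a condition at
    every position, which bounded quantification can handle. *)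
Lemma CE_derivable C T `{Coded C} `{Coded T} (Step : C -> seq T -> T -> Prop) :
  CE (fun z : C * seq T * T => Step z.1.1 z.1.2 z.2) ->
  CE (fun z : C * T => derivable Step z.1 z.2).
Proof.
move=> hS; apply: CE_ex; apply: CE_and; last first.
  by apply: CE_In; [apply/PR_snd/PR_fst/PR_id|apply/PR_snd/PR_id].
apply: CE_ext (fun x => iff_sym (derivation_drop _ _ _)) _.
apply: (CE_all_drop (P := fun (x : C * T * seq T) s y => Step x.1.1 s y)); first exact/PR_snd/PR_id.
apply: (CE_subst (f := fun z : C * T * seq T * seq T * T => (z.1.1.1.1, z.1.2, z.2)) hS).
apply: PR_pair; first apply: PR_pair.
- exact/PR_fst/PR_fst/PR_fst/PR_fst/PR_id.
- exact/PR_snd/PR_fst/PR_id.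
- exact/PR_snd/PR_id.
Qed.

Lemma derivable_ind C T (Step : C -> seq T -> T -> Prop) c (P : T -> Prop) :
  (forall s x, (forall y, In' y s -> P y) -> Step c s x -> P x) ->
  forall x, derivable Step c x -> P x.
Proof.
move=> h x [s [hs]]; elim: s hs x => [|y s IH] //= [h1 h2] x [<-|]; last exact: IH.
exact: h (IH h2) h1.
Qed.

Section Derivable.
Variables (C T : Type) (Step : C -> seq T -> T -> Prop) (c : C).
Hypothesis Step_mono : forall s t x, (forall y, In' y s -> In' y t) -> Step c s x -> Step c t x.

Lemma derivation_cat s t :
  derivation Step c s -> derivation Step c t -> derivation Step c (s ++ t).
Proof.
move=> hs ht; elim: s hs => [|x s IH] //= [h1 h2]; split; last exact: IH.
by apply: Step_mono h1 => y ys; apply/In'_cat; left.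
Qed.

(** Derivations of the premises are concatenated; monotonicity keeps each item justified when more
    items stand behind it. *)
Lemma derivable_step s x : (forall y, In' y s -> derivable Step c y) -> Step c s x ->
  derivable Step c x.
Proof.
move=> h hx; suff [t [ht st]] : exists t, derivation Step c t /\ forall y, In' y s -> In' y t.
  by exists (x :: t); split; [split=> //; apply: Step_mono hx|left].
elim: s h {hx} => [|y s IH] h; first by exists [::].
have [|t [ht st]] := IH; first by move=> z hz; apply: h; right.
have [u [hu yu]] := h y (or_introl erefl).
exists (u ++ t); split; first exact: derivation_cat.
by move=> z [<-|/st]; rewrite In'_cat; auto.
Qed.
End Derivable.

Lemma code_range_bij T U `{Coded U} (cT : T -> nat) (f : T -> U) (g : U -> T) :
  (forall x, cT x = code (f x)) -> cancel g f ->
  exists p, forall c, (exists x, cT x = c) <-> exists m, prf_eval p [:: c; m] = 0.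
Proof.
move=> e gK; have [p Hp] := @code_range U _; exists p => c; rewrite -Hp.
by split=> -[x <-]; [exists (f x)|exists (g x); rewrite e gK].
Qed.

(** * Codings of literals, finite structures and formulas *)

Lemma code_natseq (s : seq nat) : code s = code_seq s.
Proof. by rewrite /= map_id. Qed.

#[export] Instance Coded_bool : Coded bool.
Proof.
exists nat_of_bool; first by case=> -[].
(* The predecessor vanishes exactly on 0 and 1, the codes of the booleans. *)
exists p_pred => c; split=> [[b <-]|[m]]; first by exists 0; rewrite p_predE; case: b.
by rewrite p_predE; case: c => [|[|c]] // _; [exists false|exists true].
Defined.

#[export] Instance Coded_atom : Coded atom.
Proof.
exists code_atom.
  by case=> [i t|x y] [j u|z w] /cpair_inj [] // _ /cpair_inj [-> h]; rewrite ?h ?(code_seq_inj h).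
(* Only the tag needs checking: every number is a pair, and every number codes a list. *)
exists (PComp p_pred [:: p_unp1]) => c.
have E m : prf_eval (PComp p_pred [:: p_unp1]) [:: c; m] = (unp1 c).-1.
  by rewrite -(p_unp1E c [:: m]) -(p_predE _ [::]).
split=> [[a e]|[m]]; first by exists 0; rewrite E -e; case: a {e} => * /=; rewrite unp1K.
rewrite E -{2}(unpK c) -(unpK (unp2 c)).
case: (unp1 c) => [|[|]] // _; last by exists (AEq (unp1 (unp2 c)) (unp2 (unp2 c))).
by have [t et] := code_seq_surj (unp2 (unp2 c)); exists (ARel (unp1 (unp2 c)) t); rewrite /= et.
Defined.

#[export] Instance Coded_literal : Coded literal := Coded_prod Coded_bool Coded_atom.

Lemma code_fsE A : code_fs A = code (fdom A, ffacts A).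
Proof.
rewrite /code_fs /= map_id; congr (cpair _ (code_seq _)).
by apply: eq_map => -[i t] /=; rewrite map_id.
Qed.

#[export] Instance Coded_finstr : Coded finstr.
Proof.
exists code_fs.
  case=> d f [d' f']; rewrite !code_fsE => e.
  by case: (code_inj e) => -> ->.
exact: (code_range_bij (g := fun x => FinStr x.1 x.2) code_fsE (fun x => esym (surjective_pairing x))).
Defined.

Ltac pr_step := lazymatch goal with
  | H : PR ?f |- PR ?f => exact H
  | |- PR (fun x => x) => apply PR_id
  | |- PR (fun _ => ?c) => apply PR_const
  | |- PR (fun x => fst (@?f x)) => apply (PR_fst (f := f))
  | |- PR (fun x => snd (@?f x)) => apply (PR_snd (f := f))
  | |- PR (fun x => (@?f x, @?g x)) => apply (PR_pair (f := f) (g := g))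
  | |- PR (fun x => S (@?f x)) => apply (PR_S (f := f))
  | |- PR (fun x => @?f x + @?g x) => apply (PR_add (f := f) (g := g))
  | |- PR (fun x => @?f x * @?g x) => apply (PR_mul (f := f) (g := g))
  | |- PR (fun x => cpair (@?f x) (@?g x)) => apply (PR_cpair (f := f) (g := g))
  | |- PR (fun x => cons (@?f x) (@?g x)) => apply (PR_cons (f := f) (g := g))
  | |- PR (fun x => nth 0 (@?f x) (@?g x)) => apply (PR_nth (f := g) (g := f))
  | |- PR (fun x => size (@?f x)) => apply (PR_size (f := f))
  | |- PR (fun x => code (@?f x)) => apply (PR_codeT (f := f))
  end.

Ltac ce_step := cbv beta; lazymatch goal with
  | |- PR _ => pr_step
  | |- CE (fun _ => True) => apply CE_True
  | |- CE (fun x => @?P x /\ @?Q x) => apply (CE_and (P := P) (Q := Q))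
  | |- CE (fun x => @?P x \/ @?Q x) => apply (CE_or (P := P) (Q := Q))
  | |- CE (fun x => exists y, @?P x y) => apply (CE_ex (P := P))
  | |- CE (fun x => @?f x = @?g x) => apply (CE_eq (f := f) (g := g))
  | |- CE (fun x => @?f x <> @?g x) => apply (CE_neq (f := f) (g := g))
  | |- CE (fun x => is_true (@?f x <= @?g x)) => apply (CE_leq (f := f) (g := g))
  | |- CE (fun x => In' (@?f x) (@?g x)) => apply (CE_In (f := f) (g := g))
  | |- CE (fun x => forall y, In' y (@?s x) -> @?P x y) => apply (CE_all_In (P := P) (s := s))
  | |- CE (fun x => forall i, is_true (i < @?n x) -> @?P x i) => apply (CE_allb (P := P) (n := n))
  end.

(** Goals are decomposed along their syntax. The tactic is rebound whenever the stock of known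
    functions and predicates grows. *)
Ltac ce := repeat ce_step.

(** The rules generate codes rather than formulas, because they serve to show that the set of codes
    is c.e., before [qf] is available as a coded type. *)
Definition qf_code_step (_ : nat) (s : seq nat) (c : nat) : Prop :=
  c = cpair 0 0 \/ c = cpair 1 0 \/
  (exists i (vs : seq nat), c = cpair 2 (cpair i (code vs))) \/
  (exists x y, c = cpair 3 (cpair x y)) \/
  (exists g, In' g s /\ c = cpair 4 g) \/
  (exists g h, (In' g s /\ In' h s) /\ (c = cpair 5 (cpair g h) \/ c = cpair 6 (cpair g h))).

Lemma qf_code_step_mono c s t x :
  (forall y, In' y s -> In' y t) -> qf_code_step c s x -> qf_code_step c t x.
Proof.
move=> h [|[|[|[|[[g [gs e]]|[g [k [[gs ks] e]]]]]]]]; rewrite /qf_code_step; try tauto.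
  by do 4!right; left; exists g; auto.
by do 5!right; exists g, k; auto.
Qed.

Lemma code_qf_derivable (f : qf) : derivable qf_code_step 0 (code_qf f).
Proof.
elim: f => [||i vs|x y|g IH|g IHg h IHh|g IHg h IHh].
- by apply: (@derivable_step _ _ _ _ (@qf_code_step_mono 0) [::]) => //; left.
- by apply: (@derivable_step _ _ _ _ (@qf_code_step_mono 0) [::]) => //; right; left.
- apply: (@derivable_step _ _ _ _ (@qf_code_step_mono 0) [::]) => //.
  by right; right; left; exists i, vs; rewrite code_natseq.
- apply: (@derivable_step _ _ _ _ (@qf_code_step_mono 0) [::]) => //.
  by do 3!right; left; exists x, y.
- apply: (@derivable_step _ _ _ _ (@qf_code_step_mono 0) [:: code_qf g]) => [_ [<-|[]] //|].
  by do 4!right; left; exists (code_qf g); split=> //; left.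
- apply: (@derivable_step _ _ _ _ (@qf_code_step_mono 0) [:: code_qf g; code_qf h]).
    by move=> _ [<-|[<-|[]]].
  by do 5!right; exists (code_qf g), (code_qf h); rewrite /=; auto.
- apply: (@derivable_step _ _ _ _ (@qf_code_step_mono 0) [:: code_qf g; code_qf h]).
    by move=> _ [<-|[<-|[]]].
  by do 5!right; exists (code_qf g), (code_qf h); rewrite /=; auto.
Qed.

Lemma code_qf_inj : injective code_qf.
Proof.
elim=> [||i vs|x y|g IHg|g IHg h IHh|g IHg h IHh] [||j ws|z w|g'|g' h'|g' h'] //
  /cpair_inj [] //= _.
- by case/cpair_inj=> -> /code_seq_inj->.
- by case/cpair_inj=> -> ->.
- by move/IHg->.
- by case/cpair_inj=> /IHg-> /IHh->.
- by case/cpair_inj=> /IHg-> /IHh->.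
Qed.

#[export] Instance Coded_qf : Coded qf.
Proof.
exists code_qf; first exact: code_qf_inj.
have h : CE (fun c : nat => derivable qf_code_step 0 c).
  apply: (CE_subst (f := fun c : nat => (0, c)) (CE_derivable (Step := qf_code_step) _)); last by ce.
  by rewrite /qf_code_step; ce.
have [p Hp] := h; exists p => c; split=> [[f <-]|/Hp].
  exact/Hp/code_qf_derivable.
apply: (derivable_ind (P := fun c => exists f, code_qf f = c)) => s {}c IH.
case=> [->|[->|[[i [vs ->]]|[[x [y ->]]|[[g [/IH [f <-] ->]]|]]]]].
- by exists QTrue.
- by exists QFalse.
- by exists (QRel i vs); rewrite code_natseq.
- by exists (QEq x y).
- by exists (QNot f).
case=> c1 [c2 [[/IH [f <-] /IH [g <-]] [->|->]]]; [by exists (QAnd f g)|by exists (QOr f g)].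
Defined.

#[export] Instance Coded_exsent : Coded exsent.
Proof.
exists code_ex; first by case=> k f [k' f'] /cpair_inj [/= -> /code_qf_inj ->].
exact: (code_range_bij (f := fun e => (nvars e, matrix e)) (g := fun x => ExSent x.1 x.2)
         (fun _ => erefl) (fun x => esym (surjective_pairing x))).
Defined.

Section Constructors.
Context (T : Type) `{Coded T}.

Lemma PR_ARel f g : PR f -> PR g -> PR (fun x : T => ARel (f x) (g x)).
Proof.
move=> hf hg; apply/PR_code; apply: (PR_ext (f := fun x => cpair 0 (cpair (f x) (code (g x))))).
  by move=> x; rewrite code_natseq.
by ce.
Qed.

Lemma PR_AEq f g : PR f -> PR g -> PR (fun x : T => AEq (f x) (g x)).
Proof. by move=> hf hg; apply/PR_code; rewrite /=; ce. Qed.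

Lemma PR_fdom f : PR f -> PR (fun x : T => fdom (f x)).
Proof.
move=> /PR_code hf; apply/PR_code; apply: PR_ext (PR_unp1 hf) => x.
by rewrite /= code_fsE unp1K.
Qed.

Lemma PR_ffacts f : PR f -> PR (fun x : T => ffacts (f x)).
Proof.
move=> /PR_code hf; apply/PR_code; apply: PR_ext (PR_unp2 hf) => x.
by rewrite /= code_fsE unp2K.
Qed.

Lemma PR_nvars f : PR f -> PR (fun x : T => nvars (f x)).
Proof. by move=> /PR_code hf; apply/PR_code; apply: PR_ext (PR_unp1 hf) => x; apply: unp1K. Qed.

Lemma PR_matrix f : PR f -> PR (fun x : T => matrix (f x)).
Proof. by move=> /PR_code hf; apply/PR_code; apply: PR_ext (PR_unp2 hf) => x; apply: unp2K. Qed.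

Lemma PR_QRel f g : PR f -> PR g -> PR (fun x : T => QRel (f x) (g x)).
Proof.
move=> hf hg; apply/PR_code; apply: (PR_ext (f := fun x => cpair 2 (cpair (f x) (code (g x))))).
  by move=> x; rewrite code_natseq.
by ce.
Qed.

Lemma PR_QEq f g : PR f -> PR g -> PR (fun x : T => QEq (f x) (g x)).
Proof. by move=> hf hg; apply/PR_code; rewrite /=; ce. Qed.

Lemma PR_QNot f : PR f -> PR (fun x : T => QNot (f x)).
Proof. by move=> /PR_code hf; apply/PR_code; rewrite /=; ce. Qed.

Lemma PR_QAnd f g : PR f -> PR g -> PR (fun x : T => QAnd (f x) (g x)).
Proof. by move=> /PR_code hf /PR_code hg; apply/PR_code; rewrite /=; ce. Qed.

Lemma PR_QOr f g : PR f -> PR g -> PR (fun x : T => QOr (f x) (g x)).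
Proof. by move=> /PR_code hf /PR_code hg; apply/PR_code; rewrite /=; ce. Qed.
End Constructors.

Ltac pr_constructor := lazymatch goal with
  | |- PR (fun x => ARel (@?f x) (@?g x)) => apply (PR_ARel (f := f) (g := g))
  | |- PR (fun x => AEq (@?f x) (@?g x)) => apply (PR_AEq (f := f) (g := g))
  | |- PR (fun x => QRel (@?f x) (@?g x)) => apply (PR_QRel (f := f) (g := g))
  | |- PR (fun x => QEq (@?f x) (@?g x)) => apply (PR_QEq (f := f) (g := g))
  | |- PR (fun x => QAnd (@?f x) (@?g x)) => apply (PR_QAnd (f := f) (g := g))
  | |- PR (fun x => QOr (@?f x) (@?g x)) => apply (PR_QOr (f := f) (g := g))
  | |- PR (fun x => QNot (@?f x)) => apply (PR_QNot (f := f))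
  | |- PR (fun x => fdom (@?f x)) => apply (PR_fdom (f := f))
  | |- PR (fun x => ffacts (@?f x)) => apply (PR_ffacts (f := f))
  | |- PR (fun x => nvars (@?f x)) => apply (PR_nvars (f := f))
  | |- PR (fun x => matrix (@?f x)) => apply (PR_matrix (f := f))
  end.

Ltac ce ::= repeat first [ce_step | pr_constructor].

(** The right side uses only connectives and bounded quantifiers under which c.e. predicates are
    closed; the negation of a fact becomes a disequality with every listed fact. *)
Lemma DE ar A l : D ar (fs A) l <->
  (exists i t, l.2 = ARel i t /\ i < size ar /\ size t = nth 0 ar i /\
     (forall x, In' x t -> In' x (fdom A)) /\
     (l.1 = true /\ In' (i, t) (ffacts A) \/
      l.1 = false /\ forall y, In' y (ffacts A) -> y <> (i, t))) \/
  (exists x y, l.2 = AEq x y /\ In' x (fdom A) /\ In' y (fdom A) /\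
     (l.1 = true /\ x = y \/ l.1 = false /\ x <> y)).
Proof.
case: l => b [i t|x y]; rewrite /D /good_tuple /=; split.
- case=> -[hi [ht hx]] hb; left; exists i, t; do !split=> //; first by move=> x /hx /In'P.
  case: b hb => hb; [left; split=> //; exact/In'P|right; split=> // y /In'P hy e].
  by apply: hb; rewrite -e.
- case=> [[j [u [[<- <-] [h1 [h2 [h3 h4]]]]]]|[x [y []]]] //; split.
    by do !split=> //; move=> x /h3 /In'P.
  case: h4 => -[-> h4]; first exact/In'P.
  by move=> /In'P h; apply: h4 h erefl.
- case=> hx [hy hb]; right; exists x, y; do !split=> //; try exact/In'P.
  by case: b hb; auto.
- case=> [[i [t []]]|[z [w [[<- <-] [h1 [h2 h3]]]]]] //.
  by split; [exact/In'P|split; [exact/In'P|case: h3 => -[-> h]]].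
Qed.

Lemma CE_D ar : CE (fun z : finstr * literal => D ar (fs z.1) z.2).
Proof. by apply: CE_ext (fun z => iff_sym (DE ar z.1 z.2)) _; ce. Qed.

Lemma CE_fin_wf ar : CE (fin_wf ar).
Proof.
apply: (@CE_ext _ _ (fun A => forall p, In' p (ffacts A) -> p.1 < size ar /\
  size p.2 = nth 0 ar p.1 /\ forall x, In' x p.2 -> In' x (fdom A))); last by ce.
move=> A; split=> [h i t /In'P/h /= [h1 [h2 h3]]|h [i t] /In'P/h [h1 [h2 /allP h3]]].
  by do !split=> //; apply/allP => x /In'P/h3/In'P.
by split=> //; split=> // x /In'P/h3/In'P.
Qed.

(** Division with remainder is described by its quotient, so that no program computing remainders
    has to be written. *)
Lemma modn_eqP m d r : 0 < d -> r = m %% d <-> r < d /\ exists q, m = q * d + r.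
Proof.
move=> d0; split=> [->|[h [q ->]]]; last by rewrite modnMDl modn_small.
by split; [rewrite ltn_mod|exists (m %/ d); apply: divn_eq].
Qed.

Lemma DFpE p l : D ar_field (Fp_struct p) l <->
  (exists x y, l.2 = AEq x y /\ x < p /\ y < p /\ (l.1 = true /\ x = y \/ l.1 = false /\ x <> y)) \/
  (exists a b c i m r, l.2 = ARel i [:: a; b; c] /\ (a < p /\ b < p /\ c < p) /\
     (i = 0 /\ m = a + b \/ i = 1 /\ m = a * b) /\ (r < p /\ exists q, m = q * p + r) /\
     (l.1 = true /\ r = c \/ l.1 = false /\ r <> c)).
Proof.
case: l => b [i t|x y]; rewrite /D /=; split.
- case=> -[hi [ht hp]] hb; right.
  case: t ht hp hb => [|x [|y [|z [|w t]]]] ht hp hb; try by case: i hi ht {hb} => [|[|]].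
  exists x, y, z, i.
  have [hx hy hz] : [/\ x < p, y < p & z < p] by split; apply: hp; rewrite /=; auto.
  have p0 : 0 < p by apply: leq_ltn_trans hx.
  case: i hi ht hb => [|[|//]] _ _ /= hb.
    exists (x + y), ((x + y) %% p); split=> //; split=> //; split; first by auto.
    split; first exact/(modn_eqP _ _ p0).
    by case: b hb; auto.
  exists (x * y), ((x * y) %% p); split=> //; split=> //; split; first by auto.
  split; first exact/(modn_eqP _ _ p0).
  by case: b hb; auto.
- case=> [[x [y []]]|] // [x [y [z [j [m [r [[<- ->] [[hx [hy hz]] [hi [hr hb]]]]]]]]]].
  have p0 : 0 < p by apply: leq_ltn_trans hx.
  move: hr => /(modn_eqP _ _ p0) hr.
  split.
    split; first by case: hi => -[-> _].
    split; first by case: hi => -[-> _].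
    by move=> w /= [<-|[<-|[<-|[]]]].
  by case: hi hb => -[-> e]; rewrite e in hr; case=> -[-> h] /=; rewrite -hr.
- by case=> hx [hy hb]; left; exists x, y; do !split=> //; case: b hb; auto.
- case=> [[z [w [[<- <-] [h1 [h2 [[-> ->]|[-> h]]]]]]]|] //.
  by case=> a [b' [c [i [m [r []]]]]].
Qed.

Lemma CE_DFp : CE (fun z : nat * literal => D ar_field (Fp_struct z.1) z.2).
Proof. by apply: CE_ext (fun z => iff_sym (DFpE z.1 z.2)) _; ce. Qed.

(** Not being divisible by [d] is expressed positively, by an explicit nonzero remainder [r.+1]
    below [d]. *)
Lemma primeE p : prime p <->
  1 < p /\ forall d, d < p -> d <= 1 \/ exists q r, p = q * d + r.+1 /\ r.+1 < d.
Proof.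
split=> [pp|[p1 h]].
  split=> [|d ltd]; first exact: prime_gt1.
  case: (leqP d 1) => d1; [by left|right].
  have nd : 0 < p %% d.
    rewrite lt0n; apply/negP => /(prime_nt_dvdP pp) e.
    by move: ltd; rewrite -e ?ltnn // gtn_eqF.
  exists (p %/ d), (p %% d).-1; rewrite prednK // -divn_eq ltn_mod.
  by split=> //; lia.
apply/primeP; split=> // d dp; have := dvdn_leq (ltnW p1) dp.
rewrite leq_eqVlt => /orP[/eqP->|/h [d1|[q [r [e lr]]]]]; first by rewrite eqxx orbT.
  by case: d dp d1 => [|[|d]] //; rewrite dvd0n => /eqP e0; rewrite e0 in p1.
by move: dp; rewrite /dvdn e modnMDl modn_small.
Qed.

Lemma CE_prime : CE (fun p => prime p).
Proof. by apply: CE_ext (fun z => iff_sym (primeE z)) _; ce. Qed.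

Ltac ce_named := lazymatch goal with
  | H : CE ?P |- CE (fun x => ?P (@?f x)) => apply (CE_subst (f := f) H)
  | H : PR ?f |- PR (fun x => ?f (@?g x)) => apply (PR_comp H (f := g))
  | |- CE (fun x => D ?ar (fs (@?f x)) (@?g x)) =>
      apply (CE_subst (f := fun x => (f x, g x)) (CE_D ar))
  | |- CE (fun x => D ar_field (Fp_struct (@?f x)) (@?g x)) =>
      apply (CE_subst (f := fun x => (f x, g x)) CE_DFp)
  | |- CE (fun x => fin_wf ?ar (@?f x)) => apply (CE_subst (f := f) (CE_fin_wf ar))
  | |- CE (fun x => is_true (prime (@?f x))) => apply (CE_subst (f := f) CE_prime)
  end.

Ltac ce ::= repeat first [ce_step | pr_constructor | ce_named].

Lemma ce_familyE T `{Coded T} (W : nat -> T -> Prop) :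
  ce_family code W <-> CE (fun z : T * nat => W z.2 z.1).
Proof.
split=> -[p Hp].
  exists (PComp p [:: PComp p_unp2 [:: PProj 0]; PComp p_unp1 [:: PProj 0]; PProj 1]) => -[x n].
  have E m : prf_eval (PComp p [:: PComp p_unp2 [:: PProj 0]; PComp p_unp1 [:: PProj 0]; PProj 1])
      [:: code (x, n); m] = prf_eval p [:: n; code x; m].
    transitivity (prf_eval p [:: unp2 (cpair (code x) n); unp1 (cpair (code x) n); m]).
      by rewrite -(p_unp2E _ [::]) -(p_unp1E _ [::]).
    by rewrite unp2K unp1K.
  by rewrite Hp; split=> -[m h]; exists m; rewrite E in h *.
exists (PComp p [:: PComp p_pair [:: PProj 1; PProj 0]; PProj 2]) => n x.
have E m : prf_eval (PComp p [:: PComp p_pair [:: PProj 1; PProj 0]; PProj 2]) [:: n; code x; m] =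
  prf_eval p [:: code (x, n); m].
  by rewrite [code (x, n)]/= -(p_pairE _ _ [::]).
by rewrite (Hp (x, n)); split=> -[m h]; exists m; rewrite E in h *.
Qed.

(** * Structures, diagrams and isomorphisms *)

Section Structures.
Variable ar : seq nat.
Implicit Types A B C : structure.

Lemma good_tuple_map A B f i t : (forall x, sdom A x -> sdom B (f x)) ->
  good_tuple ar A i t -> good_tuple ar B i (map f t).
Proof.
move=> hf [hi [ht hx]]; split=> //; split; first by rewrite size_map.
by move=> _ /In'_map [x /hx /hf h <-].
Qed.

Lemma iso_refl A : iso ar A A.
Proof. by exists id; do !split=> //; [move=> y; exists y|rewrite map_id|rewrite map_id]. Qed.

(** An isomorphism is a map on all of omega constrained only on the universe of its source, so the
    inverse chooses preimages on the universe of [B] and is arbitrary elsewhere. *)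
Lemma iso_sym A B : iso ar A B -> iso ar B A.
Proof.
case=> f [f1 [f2 [f3 f4]]].
pose g y := epsilon (inhabits 0) (fun x => sdom A x /\ f x = y).
have gP y : sdom B y -> sdom A (g y) /\ f (g y) = y by move=> /f3; apply: epsilon_spec.
exists g; split; first by move=> y /gP [].
split; first by move=> x y /gP [_ {2}<-] /gP [_ {2}<-] ->.
split.
  move=> x hx; exists (f x); split; first exact: f1.
  by have [h1 h2] := gP _ (f1 _ hx); apply: f2.
move=> i t ht; have h : good_tuple ar A i (map g t) by apply: good_tuple_map ht => y /gP [].
rewrite (f4 _ _ h) -map_comp.
suff -> : map (f \o g) t = t by [].
case: ht => _ [_]; elim: t {h} => //= x t IH h.
by rewrite IH; [rewrite (gP x _).2 //; apply: h; left|move=> y hy; apply: h; right].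
Qed.

Lemma iso_trans A B C : iso ar A B -> iso ar B C -> iso ar A C.
Proof.
case=> f [f1 [f2 [f3 f4]]] [g [g1 [g2 [g3 g4]]]]; exists (g \o f).
split; first by move=> x /f1 /g1.
split; first by move=> x y hx hy /g2 e; apply: f2 => //; apply: e; apply: f1.
split; first by move=> z /g3 [y [/f3 [x [hx <-]] <-]]; exists x.
by move=> i t ht; rewrite f4 // map_comp g4 //; apply: good_tuple_map ht.
Qed.

Lemma iso_of_D A B : (forall l, D ar A l <-> D ar B l) -> iso ar A B.
Proof.
(* The universe can be read off the diagram: [x = x] belongs to it iff [x] is an element. *)
move=> h; have hd x : sdom A x <-> sdom B x.
  by have := h (true, AEq x x); rewrite /D /=; tauto.
exists id; split; first by move=> x /hd.
split=> //; split; first by move=> y /hd; exists y.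
move=> i t ht; have ht' : good_tuple ar B i t.
  by case: ht => hi [hs hx]; split=> //; split=> // x /hx /hd.
by have := h (true, ARel i t); rewrite /D /= map_id; tauto.
Qed.

Lemma D_wf A l : D ar A l -> wf_lit ar l.
Proof. by case: l => b [i t|x y] // [[hi [ht _]] _]. Qed.

Lemma D_total A i t : good_tuple ar A i t -> exists b, D ar A (b, ARel i t).
Proof. by move=> h; case: (classic (srel A i t)) => hr; [exists true|exists false]. Qed.

Lemma good_tuple_substr A B i t : substr ar A B -> good_tuple ar A i t -> good_tuple ar B i t.
Proof. by case=> h _ [hi [hs hx]]; split=> //; split=> // x /hx /h. Qed.

Lemma D_substr A B l : substr ar A B -> D ar A l -> D ar B l.
Proof.
move=> s; have [h1 h2] := s; case: l => b [i t|x y]; rewrite /D /=; last by case=> /h1 ? [/h1].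
case=> ht hb; split; first exact: good_tuple_substr ht.
by case: b hb; rewrite h2.
Qed.

Definition lit_consts (l : literal) : seq nat :=
  match l.2 with ARel _ t => t | AEq x y => [:: x; y] end.

Lemma lit_consts_D A l x : D ar A l -> In' x (lit_consts l) -> sdom A x.
Proof.
case: l => b [i t|y z]; rewrite /D /lit_consts /=; first by case=> -[_ [_ h]] _ /h.
by case=> hy [hz _] [<-|[<-|[]]].
Qed.

Lemma D_restrict A B l : substr ar A B -> D ar B l ->
  (forall x, In' x (lit_consts l) -> sdom A x) -> D ar A l.
Proof.
case=> h1 h2; case: l => b [i t|y z]; rewrite /D /lit_consts /=.
  case=> [[hi [hs _]] hb] hx; have ht : good_tuple ar A i t by [].
  by split=> //; case: b hb; rewrite h2.
by case=> _ [_ hb] hx; split; [|split=> //]; apply: hx; auto.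
Qed.

(** * Finite pieces of a structure *)

Fixpoint tuples (xs : seq nat) (k : nat) : seq (seq nat) :=
  if k is k'.+1 then [seq x :: t | x <- xs, t <- tuples xs k'] else [:: [::]].

Lemma mem_tuples xs k t : (t \in tuples xs k) = (size t == k) && all (mem xs) t.
Proof.
elim: k t => [|k IH] t; first by case: t.
apply/allpairsP/idP => /=.
  by case=> -[x u] /= [hx]; rewrite IH => /andP[/eqP hu ha] -> /=; rewrite hu eqxx hx.
case: t => [|x t] //= /andP[hs /andP[hx ha]].
by exists (x, t); rewrite /= IH ha andbT.
Qed.

(** Relations of a structure are arbitrary propositions, so the sublist exists only classically; it
    supplies the facts of a finite substructure. *)
Lemma exists_filter (T : eqType) (P : T -> Prop) (s : seq T) :
  exists s' : seq T, forall x, x \in s' <-> x \in s /\ P x.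
Proof.
elim: s => [|y s [s' h]]; first by exists [::] => x; rewrite in_nil; split=> [|[]].
case: (classic (P y)) => hy.
  exists (y :: s') => x; rewrite !inE; split.
    by case/orP=> [/eqP->|/h[-> hp]]; rewrite ?eqxx ?orbT.
  case=> /orP[/eqP->|hx] hp; first by rewrite eqxx.
  by apply/orP; right; apply/h.
exists s' => x; rewrite h inE; split=> [[-> hp]|[/orP[/eqP e|hx] hp]]; rewrite ?orbT //.
by case: hy; rewrite -e.
Qed.

Lemma finite_restriction B xs : (forall x, In' x xs -> sdom B x) ->
  exists A : finstr, fin_wf ar A /\ fdom A = xs /\ substr ar (fs A) B.
Proof.
move=> hx.
have [F hF] := exists_filter (fun p => srel B p.1 p.2)
  [seq (i, t) | i <- iota 0 (size ar), t <- tuples xs (nth 0 ar i)].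
have {}hF i t : (i, t) \in F <->
    [/\ i < size ar, size t = nth 0 ar i, all (mem xs) t & srel B i t].
  rewrite hF; split=> [[/allpairsPdep [j [u [hj hu [-> ->]]]] hr]|[h1 h2 h3 h4]].
    by move: hj hu; rewrite mem_iota mem_tuples => h /andP[/eqP ? ?]; split.
  by split=> //; apply/allpairsPdep; exists i, t; rewrite mem_iota mem_tuples h2 eqxx.
exists (FinStr xs F); split; first by move=> i t /hF [h1 h2 h3 _].
split=> //; split=> [x /In'P /hx //|i t [h1 [h2 h3]]] /=.
rewrite hF; split=> [[]//|h]; split=> //.
by apply/allP => x /In'P/h3.
Qed.

Lemma finite_diagram B alpha : (forall l, In' l alpha -> D ar B l) ->
  exists A : finstr, fin_wf ar A /\ substr ar (fs A) B /\ forall l, In' l alpha -> D ar (fs A) l.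
Proof.
move=> h; have hc x l : In' l alpha -> In' x (lit_consts l) -> In' x (flatten (map lit_consts alpha)).
  elim: alpha {h} => //= m s IH [->|hl] hx; rewrite In'_cat; [by left|by right; apply: IH].
have [x|A [h1 [h2 h3]]] := @finite_restriction B (flatten (map lit_consts alpha)).
  move=> hx; suff [l hl /(lit_consts_D (h _ hl))] : exists2 l, In' l alpha & In' x (lit_consts l) by [].
  elim: alpha {h hc} hx => //= m s IH /In'_cat [hx|/IH [l hl hx]]; first by exists m; auto.
  by exists l; auto.
exists A; do !split=> //; try by case: h3.
move=> l hl; apply: D_restrict h3 (h _ hl) _ => x hx.
by rewrite /= h2; apply/In'P; apply: hc hx.
Qed.

(** Elements are added one at a time, each wrong value being corrected by a transposition. *)
Lemma permutation_extension (f : nat -> nat) (s : seq nat) :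
  {in s &, injective f} -> exists h g : nat -> nat, cancel h g /\ cancel g h /\ {in s, h =1 f}.
Proof.
elim: s => [|a s IH] hf; first by exists id, id.
have [|h [g [hK [gK hh]]]] := IH; first by move=> x y hx hy; apply: hf; rewrite inE ?hx ?hy orbT.
case as_ : (a \in s).
  by exists h, g; do !split=> //; move=> x; rewrite inE => /orP[/eqP->|]; apply: hh.
(* The transposition of [h a] and [f a]. It fixes [f x] for [x] in [s]: this value differs from
   [h a] because [h] is injective, and from [f a] because [f] is. *)
pose sw z := if z == h a then f a else if z == f a then h a else z.
have swK : cancel sw sw.
  move=> z; rewrite /sw; case: (z =P h a) => [->|/eqP n1].
    by rewrite eqxx; case: eqP => [->|].
  case: (z =P f a) => [->|/eqP n2]; first by rewrite eqxx.
  by rewrite (negbTE n1) (negbTE n2).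
exists (sw \o h), (g \o sw); split; first by move=> x /=; rewrite swK hK.
split; first by move=> x /=; rewrite gK swK.
move=> x; rewrite inE /sw /= => /orP[/eqP->|xs]; first by rewrite eqxx.
have xa : x != a by apply/eqP => e; rewrite -e xs in as_.
rewrite (can_eq hK) (negbTE xa) hh //; case: eqP => // e.
by move/eqP: xa; case; apply: hf; rewrite ?inE ?eqxx ?xs ?orbT.
Qed.

(** [B] is pulled back along a permutation of omega that extends the embedding, after which the copy
    of [A] is [A] itself. *)
Lemma embedding_substr (A : finstr) B f :
  (forall x, sdom (fs A) x -> sdom B (f x)) ->
  (forall x y, sdom (fs A) x -> sdom (fs A) y -> f x = f y -> x = y) ->
  (forall i t, good_tuple ar (fs A) i t -> (srel (fs A) i t <-> srel B i (map f t))) ->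
  exists B', iso ar B' B /\ substr ar (fs A) B'.
Proof.
move=> f1 f2 f3; have [|h [g [hK [gK hh]]]] := @permutation_extension f (fdom A); first exact: f2.
exists {| sdom := fun x => sdom B (h x); srel := fun i t => srel B i (map h t) |}; split.
  exists h; do !split=> //; first by move=> x y _ _; apply: (can_inj hK).
  by move=> y hy; exists (g y); rewrite /= gK.
split=> [x hx|i t ht]; first by rewrite /= hh //; apply: f1.
rewrite f3 //=; suff -> : map h t = map f t by [].
by apply/eq_in_map => x xt; apply: hh; case: ht => _ [_]; apply; apply/In'P.
Qed.
End Structures.

(** * Evaluation of quantifier-free formulas *)

(* [(b, f)] is derived when the literals [c.1] force the truth value [b] on [f] under the valuation [c.2]. *)
Definition eval_step (c : seq literal * seq nat) (s : seq (bool * qf)) (x : bool * qf) : Prop :=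
  x = (true, QTrue) \/ x = (false, QFalse) \/
  (exists i vs t, (x.2 = QRel i vs /\ size t = size vs /\
     forall j, j < size vs -> nth 0 t j = nth 0 c.2 (nth 0 vs j)) /\ In' (x.1, ARel i t) c.1) \/
  (exists j k, x.2 = QEq j k /\ In' (x.1, AEq (nth 0 c.2 j) (nth 0 c.2 k)) c.1) \/
  (exists b g, x.2 = QNot g /\ In' (b, g) s /\ b <> x.1) \/
  (exists g h, x = (true, QAnd g h) /\ In' (true, g) s /\ In' (true, h) s) \/
  (exists g h, x = (false, QAnd g h) /\ (In' (false, g) s \/ In' (false, h) s)) \/
  (exists g h, x = (false, QOr g h) /\ In' (false, g) s /\ In' (false, h) s) \/
  (exists g h, x = (true, QOr g h) /\ (In' (true, g) s \/ In' (true, h) s)).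

(** [eval_step] specifies the instantiated tuple [t] entry by entry, staying within [size], [nth]
    and a bounded quantifier. *)
Lemma CE_eval_step :
  CE (fun z : (seq literal * seq nat) * seq (bool * qf) * (bool * qf) =>
        eval_step z.1.1 z.1.2 z.2).
Proof. by rewrite /eval_step; ce. Qed.

Lemma eval_step_mono c c' s s' x : c.2 = c'.2 -> (forall l, In' l c.1 -> In' l c'.1) ->
  (forall y, In' y s -> In' y s') -> eval_step c s x -> eval_step c' s' x.
Proof.
case: c c' => a v [a' v'] /= <- ha hs; rewrite /eval_step /=.
case; first by left.
case; first by right; left.
case=> [[i [vs [t [h /ha h']]]]|]; first by do 2!right; left; exists i, vs, t.
case=> [[j [k [h /ha h']]]|]; first by do 3!right; left; exists j, k.
case=> [[b [g [h [/hs h1 h2]]]]|]; first by do 4!right; left; exists b, g.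
case=> [[g [h [e [/hs h1 /hs h2]]]]|]; first by do 5!right; left; exists g, h.
case=> [[g [h [e h1]]]|]; first by do 6!right; left; exists g, h; split=> //; case: h1 => /hs; auto.
case=> [[g [h [e [/hs h1 /hs h2]]]]|]; first by do 7!right; left; exists g, h.
by case=> [g [h [e h1]]]; do 8!right; exists g, h; split=> //; case: h1 => /hs; auto.
Qed.

Lemma eval_mono a a' v x : (forall l, In' l a -> In' l a') ->
  derivable eval_step (a, v) x -> derivable eval_step (a', v) x.
Proof.
move=> ha; apply: derivable_ind => s {}x hs hx.
apply: (@derivable_step _ _ eval_step _ _ s) => //; first by move=> s1 s2 y h; apply: eval_step_mono.
exact: eval_step_mono hx.
Qed.

Lemma eval_sound ar B a v x : (forall l, In' l a -> D ar B l) ->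
  derivable eval_step (a, v) x -> if x.1 then holds_qf B v x.2 else ~ holds_qf B v x.2.
Proof.
move=> ha; apply: (derivable_ind (P := fun x => if x.1 then holds_qf B v x.2 else ~ holds_qf B v x.2)).
move=> s {}x IH; case.
  by move->.
case; first by move->; case.
case.
  case: x => b f /= [i [vs [t [[-> [hs ht]] /ha [_ /= h]]]]].
  suff <- : t = map (nth 0 v) vs by [].
  by apply: (@eq_from_nth _ 0); rewrite ?size_map // => j; rewrite hs => hj; rewrite (nth_map 0) // ht.
case; first by case: x => b f /= [j [k [-> /ha [_ [_ /= h]]]]].
case.
  by case: x => b f /= [b' [g [-> [/IH /= h hb]]]]; case: b b' hb h => -[] //= _ h; apply.
case; first by case=> g [h [-> [/IH h1 /IH h2]]].
case; first by case=> g [h [-> [] /IH /= h1]]; case=> h2 h3; apply: h1.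
case; first by case=> g [h [-> [/IH /= h1 /IH /= h2]]]; case.
by case=> g [h [-> [] /IH /= h1]]; [left|right].
Qed.

(** Some truth value is always forced by finitely many true literals. Treating both values at once
    carries the induction through negation; for two subformulas the literal sets are merged by
    [eval_mono]. *)
Lemma eval_complete ar B v f : (forall x, In' x v -> sdom B x) -> wf_qf ar (size v) f ->
  exists a b, (forall l, In' l a -> D ar B l) /\ derivable eval_step (a, v) (b, f).
Proof.
move=> hv.
have stepI a s x : (forall y, In' y s -> derivable eval_step (a, v) y) ->
    eval_step (a, v) s x -> derivable eval_step (a, v) x.
  by apply: derivable_step => s1 s2 y h; apply: eval_step_mono.
have hn j : j < size v -> sdom B (nth 0 v j) by move=> hj; apply/hv/In'P/mem_nth.
have two g h : (exists a b, (forall l, In' l a -> D ar B l) /\ derivable eval_step (a, v) (b, g)) ->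
    (exists a b, (forall l, In' l a -> D ar B l) /\ derivable eval_step (a, v) (b, h)) ->
    exists a b c, (forall l, In' l a -> D ar B l) /\
      forall y, In' y [:: (b, g); (c, h)] -> derivable eval_step (a, v) y.
  case=> a [b [ha hb]] [a' [c [ha' hc]]]; exists (a ++ a'), b, c; split.
    by move=> l /In'_cat [/ha|/ha'].
  move=> y [<-|[<-|[]]]; [apply: eval_mono hb|apply: eval_mono hc] => l hl; rewrite In'_cat; auto.
elim: f => [||i vs|j k|g IH|g IHg h IHh|g IHg h IHh] /=.
- by exists [::], true; split=> //; apply: (stepI _ [::]) => //; left.
- by exists [::], false; split=> //; apply: (stepI _ [::]) => //; right; left.
- case=> hi [hs ht].
  have /D_total [b hb] : good_tuple ar B i (map (nth 0 v) vs).
    split=> //; split; first by rewrite size_map.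
    by move=> _ /In'_map [j /In'P hj <-]; apply: hn; apply: (allP ht).
  exists [:: (b, ARel i (map (nth 0 v) vs))], b; split; first by move=> l [<-|[]].
  apply: (stepI _ [::]) => //; do 2!right; left.
  exists i, vs, (map (nth 0 v) vs); split; last by left.
  by split=> //; split=> [|j hj]; rewrite ?size_map // (nth_map 0).
- case=> hj hk.
  have [b hb] : exists b, D ar B (b, AEq (nth 0 v j) (nth 0 v k)).
    case: (classic (nth 0 v j = nth 0 v k)) => h; [exists true|exists false]; do !split=> //; exact: hn.
  exists [:: (b, AEq (nth 0 v j) (nth 0 v k))], b; split; first by move=> l [<-|[]].
  by apply: (stepI _ [::]) => //; do 3!right; left; exists j, k; split=> //; left.
- move=> /IH [a [b [ha hb]]]; exists a, (~~ b); split=> //.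
  apply: (stepI _ [:: (b, g)]) => [y [<-|[]] //|]; do 4!right; left.
  by exists b, g; split=> //; split; [left|case: b {hb}].
- case=> /IHg hg /IHh hh; have [a [b [c [ha hbc]]]] := two _ _ hg hh.
  exists a, (b && c); split=> //; apply: stepI hbc _.
  case: b; case: c.
  + by do 5!right; left; exists g, h; rewrite /=; auto.
  + by do 6!right; left; exists g, h; rewrite /=; auto.
  + by do 6!right; left; exists g, h; rewrite /=; auto.
  + by do 6!right; left; exists g, h; rewrite /=; auto.
- case=> /IHg hg /IHh hh; have [a [b [c [ha hbc]]]] := two _ _ hg hh.
  exists a, (b || c); split=> //; apply: stepI hbc _.
  case: b; case: c.
  + by do 8!right; exists g, h; rewrite /=; auto.
  + by do 8!right; exists g, h; rewrite /=; auto.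
  + by do 8!right; exists g, h; rewrite /=; auto.
  + by do 7!right; left; exists g, h; rewrite /=; auto.
Qed.

(** * Conjunctions of literals *)

Definition qf_lit (l : literal) : qf :=
  let a := match l.2 with ARel i t => QRel i t | AEq x y => QEq x y end in
  if l.1 then a else QNot a.

Definition qf_conj (ls : seq literal) : qf := foldr (fun l m => QAnd (qf_lit l) m) QTrue ls.

(** Generates the graph of [qf_conj] inductively. A c.e. graph suffices for the applications, so the
    fold itself need not be programmed. *)
Definition conj_step (_ : nat) (s : seq (seq literal * qf)) (x : seq literal * qf) : Prop :=
  x = ([::], QTrue) \/
  exists l ls q m, x = (l :: ls, QAnd q m) /\ In' (ls, m) s /\ exists a,
    ((exists i t, l.2 = ARel i t /\ a = QRel i t) \/ (exists y z, l.2 = AEq y z /\ a = QEq y z)) /\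
    (l.1 = true /\ q = a \/ l.1 = false /\ q = QNot a).

Lemma conj_stepE ls f : derivable conj_step 0 (ls, f) <-> f = qf_conj ls.
Proof.
split.
  apply: (derivable_ind (P := fun x => x.2 = qf_conj x.1)) => s x IH [->//|].
  case=> l [{}ls [q [m [-> [/IH /= -> [a [ha hq]]]]]]]; rewrite /qf_lit /=.
  by case: ha => -[y [z [-> ->]]] in hq *; case: hq => -[-> ->].
move->; have mono s t x : (forall y, In' y s -> In' y t) -> conj_step 0 s x -> conj_step 0 t x.
  move=> h [->|[l [l' [q [m [e [/h h1 h2]]]]]]]; [by left|right].
  by exists l, l', q, m.
elim: ls => [|l ls IH]; first by apply: (@derivable_step _ _ conj_step 0 mono [::]) => //; left.
apply: (@derivable_step _ _ conj_step 0 mono [:: (ls, qf_conj ls)]) => [y [<-|[]] //|].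
right; exists l, ls, (qf_lit l), (qf_conj ls); do 2!split=> //; first by left.
exists (match l.2 with ARel i t => QRel i t | AEq x y => QEq x y end).
split; last by rewrite /qf_lit; case: l.1; auto.
by case: l.2 => [i t|x y]; [left; exists i, t|right; exists x, y].
Qed.

Lemma CE_conj : CE (fun z : seq literal * qf => z.2 = qf_conj z.1).
Proof.
apply: (@CE_ext _ _ (fun z : seq literal * qf => derivable conj_step 0 z)).
  by case=> ls f; apply: conj_stepE.
have h : CE (fun z : nat * (seq literal * qf) => derivable conj_step z.1 z.2).
  by apply: CE_derivable; rewrite /conj_step; ce.
by apply: (CE_subst (f := fun z => (0, z)) h); ce.
Qed.

Lemma holds_conj B v ls :
  holds_qf B v (qf_conj ls) <-> forall l, In' l ls -> holds_qf B v (qf_lit l).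
Proof.
elim: ls => [|l ls IH] //=; rewrite IH; split=> [[h1 h2] m [<-|] //|h]; first exact: h2.
by split=> [|m hm]; apply: h; auto.
Qed.

(** * Injective enumeration of primes *)

Lemma exists_prime_above (a : nat) : exists p, (a < p) && prime p.
Proof. by have [p h1 h2] := prime_above a; exists p; rewrite h1. Qed.

Definition next_prime (a : nat) : nat := ex_minn (exists_prime_above a).

(** Minimality is made positive: every number between [a] and [b] is below 2 or an explicit product
    of two factors that are at least 2. *)
Lemma next_primeE a b : b = next_prime a <->
  a < b /\ prime b /\ forall c, c < b -> c <= a \/ c < 2 \/ exists d q, c = q.+2 * d.+2.
Proof.
rewrite /next_prime; case: ex_minnP => p /andP[ap pp] pmin; split.
  move=> ->; split=> //; split=> // c cp.
  case: (leqP c a) => ca; [by left|right].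
  have /primePn : ~~ prime c.
    by apply/negP => pc; have := pmin c; rewrite ca pc => /(_ isT); rewrite leqNgt cp.
  case=> [|[d /andP[d1 dc] /dvdnP [q e]]]; [by left|right].
  have [q2 d2] : 1 < q /\ 1 < d by split=> //; nia.
  by exists d.-2, q.-2; rewrite e; congr (_ * _); lia.
case=> ab [pb h]; apply/eqP; rewrite eqn_leq pmin ?ab // andbT leqNgt; apply/negP => /h.
case; first by rewrite leqNgt ap.
case; first by rewrite ltnNge prime_gt1.
case=> d [q e]; move: pp; apply/negP/primePn; right; exists d.+2; last by rewrite e dvdn_mull.
by rewrite e; nia.
Qed.

Definition prime_enum (n : nat) : nat := iter n next_prime 2.

Lemma prime_enum_prime n : prime (prime_enum n).
Proof. by case: n => // n; have [] := (next_primeE (prime_enum n) _).1 erefl => _ []. Qed.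

Lemma prime_enum_inj : injective prime_enum.
Proof.
apply: incn_inj; apply: leq_mono; apply: homo_ltn; first exact: ltn_trans.
by move=> n; have [] := (next_primeE (prime_enum n) _).1 erefl.
Qed.

(** The iteration is replaced by the list [s] of its successive values, each checked against the
    preceding one. *)
Lemma CE_prime_enum : CE (fun z : nat * nat => z.2 = prime_enum z.1).
Proof.
apply: (@CE_ext _ _ (fun z : nat * nat => exists s : seq nat,
  nth 0 s 0 = 2 /\ z.2 = nth 0 s z.1 /\ forall i, i < z.1 ->
    nth 0 s i < nth 0 s i.+1 /\ prime (nth 0 s i.+1) /\
    forall c, c < nth 0 s i.+1 -> c <= nth 0 s i \/ c < 2 \/ exists d q, c = q.+2 * d.+2));
  last by ce.
case=> n p /=; split=> [[s [s0 [-> hs]]]|->].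
  suff h i : i <= n -> nth 0 s i = prime_enum i by apply: h.
  elim: i => // i IH hi; rewrite /prime_enum iterS -/(prime_enum i) -IH; last exact: ltnW.
  exact/next_primeE/hs.
exists (mkseq prime_enum n.+1); split=> //; split; first by rewrite nth_mkseq.
move=> i hi; rewrite !nth_mkseq //; last exact: ltnW.
exact/next_primeE.
Qed.

(** * The characteristic of a prime field *)

(* The entries of [s] are [0], [c], [2c], up to [n c = 0], with [c] nonzero;
   [X] plays the role of an atomic diagram. *)
Definition char_witness (X : literal -> Prop) (n c : nat) (s : seq nat) : Prop :=
  X (false, AEq (nth 0 s 0) c) /\
  X (true, ARel 0 [:: nth 0 s 0; nth 0 s 0; nth 0 s 0]) /\
  nth 0 s n = nth 0 s 0 /\
  forall i, i < n -> X (true, ARel 0 [:: nth 0 s i; c; nth 0 s i.+1]).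

(** All the literals that [char_witness] queries. Its clause [nth 0 s n = nth 0 s 0] equates two
    elements of omega and contributes none. *)
Definition char_literals (n c : nat) (s : seq nat) : seq literal :=
  (false, AEq (nth 0 s 0) c) :: (true, ARel 0 [:: nth 0 s 0; nth 0 s 0; nth 0 s 0]) ::
  [seq (true, ARel 0 [:: nth 0 s i; c; nth 0 s i.+1]) | i <- iota 0 n].

Lemma char_witness_sub (X Y : literal -> Prop) n c s :
  (forall l, In' l (char_literals n c s) -> X l -> Y l) ->
  char_witness X n c s -> char_witness Y n c s.
Proof.
move=> h [h1 [h2 [h3 h4]]]; split; first by apply: h h1; left.
split; first by apply: h h2; right; left.
split=> // i hi; apply: h (h4 _ hi); right; right; apply/In'_map; exists i => //.
by apply/In'P; rewrite mem_iota.
Qed.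

Lemma char_witness_literals (X : literal -> Prop) n c s :
  char_witness X n c s -> forall l, In' l (char_literals n c s) -> X l.
Proof.
case=> h1 [h2 [_ h4]] l [<-//|[<-//|/In'_map [i /In'P]]].
by rewrite mem_iota => hi <-; apply: h4.
Qed.

Lemma char_witness_exists p F : prime p -> iso ar_field (Fp_struct p) F ->
  exists c s, char_witness (D ar_field F) p c s.
Proof.
move=> pp [g [g1 [g2 [_ g4]]]].
have p1 := prime_gt1 pp; have p0 := ltnW p1.
have add a b : a < p -> b < p -> D ar_field F (true, ARel 0 [:: g a; g b; g ((a + b) %% p)]).
  move=> ha hb; have ht : good_tuple ar_field (Fp_struct p) 0 [:: a; b; (a + b) %% p].
    by do !split=> //; move=> x /= [<-|[<-|[<-|[]]]] //; rewrite ltn_mod.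
  by split; [apply: good_tuple_map ht|apply/(g4 _ _ ht)].
(* The multiples of the unit [g 1], from 0 through [p]; the last index wraps around to [g 0]. *)
pose s := mkseq (fun i => g (i %% p)) p.+1.
have sE i : i <= p -> nth 0 s i = g (i %% p) by move=> hi; rewrite nth_mkseq.
exists (g 1), s; split; first rewrite sE // mod0n.
  do !split; try exact: g1; move=> /(g2 0 1 p0 p1); by [].
split; first by rewrite sE // mod0n; have := add 0 0 p0 p0; rewrite mod0n.
split; first by rewrite !sE // modnn mod0n.
move=> i hi; rewrite !sE //; last exact: ltnW.
by have := add (i %% p) 1 (ltn_pmod _ p0) p1; rewrite modnDml addn1.
Qed.

(** Transported to residues, the witness says that [p] divides [n * c'], where [c'] is a nonzero
    residue. By Euclid's lemma [p] divides [n], and primality of [n] gives equality. *)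
Lemma char_witness_unique p n F c s : prime p -> prime n -> iso ar_field (Fp_struct p) F ->
  char_witness (D ar_field F) n c s -> n = p.
Proof.
move=> pp pn [g [g1 [g2 [g3 g4]]]] [h1 [h2 [h3 h4]]].
have p0 := prime_gt0 pp.
have add x y z : D ar_field F (true, ARel 0 [:: x; y; z]) -> exists a b,
    [/\ a < p, b < p, x = g a, y = g b & z = g ((a + b) %% p)].
  case=> -[_ [_ hx]] hr.
  have [a [ha ea]] := g3 x (hx _ (or_introl erefl)).
  have [b [hb eb]] := g3 y (hx _ (or_intror (or_introl erefl))).
  have [d [hd ed]] := g3 z (hx _ (or_intror (or_intror (or_introl erefl)))).
  have ht : good_tuple ar_field (Fp_struct p) 0 [:: a; b; d].
    by do !split=> //; move=> w /= [<-|[<-|[<-|[]]]].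
  exists a, b; split=> //; rewrite -ed; congr g.
  by apply/esym; apply/(g4 _ _ ht); rewrite /= ea eb ed.
have [a [a' [ha ha' e1 e2]]] := add _ _ _ h2; rewrite {1}e1 => e3.
have eaa : a' = a by apply: g2 => //; rewrite -e1 -e2.
(* The literal for [0 + 0 = 0] says that [2a] and [a] agree modulo [p], with [a < p]. *)
have a0 : a = 0.
  have := g2 a _ ha (ltn_pmod (a + a') p0) e3; rewrite eaa => e.
  by case: (ltnP (a + a) p) => hl; [rewrite modn_small // in e; lia|
     rewrite -(subnK hl) modnDr modn_small in e; lia].
(* Since [n] is positive there is a first addition, and [c] is one of its arguments, hence an
   element of the field. *)
have [c' hc ec] : exists2 c', c' < p & c = g c'.
  by have [b [b' [_ hb _ eb _]]] := add _ _ _ (h4 0 (prime_gt0 pn)); exists b'.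
have mul i : i <= n -> nth 0 s i = g ((i * c') %% p).
  elim: i => [|i IH] hi; first by rewrite mul0n mod0n e1 a0.
  have [b [b' [hb hb' eb eb' ->]]] := add _ _ _ (h4 i hi).
  have -> : b' = c' by apply: g2 => //; rewrite -eb'.
  have -> : b = (i * c') %% p by apply: g2 => //=; rewrite ?ltn_mod // -eb IH // ltnW.
  by rewrite modnDml mulSnr.
have hd : p %| n * c'.
  have e : g ((n * c') %% p) = g 0 by rewrite -mul // h3 e1 a0.
  by rewrite /dvdn; apply/eqP/(g2 _ _ _ _ e); rewrite //= ltn_mod.
move: hd; rewrite Euclid_dvdM // => /orP[|/dvdn_leq hd].
  by rewrite dvdn_prime2 // => /eqP.
have c0 : c' = 0 by case: (posnP c') => // /hd; rewrite leqNgt hc.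
by case: h1 => _ [_]; rewrite /= e1 ec a0 c0.
Qed.

Lemma leq_nth_sumn s i : nth 0 s i <= sumn s.
Proof. by elim: s i => [|a s IH] [|i] //=; [apply: leq_addr|apply: leq_trans (IH i) (leq_addl _ _)]. Qed.

Lemma mem_leq_sumn x s : x \in s -> x <= sumn s.
Proof. by move=> hx; rewrite -(nth_index 0 hx) leq_nth_sumn. Qed.

Lemma CE_Phi_app ar Phi : CE Phi ->
  CE (fun z : finstr * literal => Phi_app ar Phi (fs z.1) z.2).
Proof. by move=> h; rewrite /Phi_app; ce. Qed.

Ltac ce_derived := cbv beta; lazymatch goal with
  | H : CE ?Phi |- CE (fun x => Phi_app ?ar ?Phi (fs (@?f x)) (@?g x)) =>
      apply (CE_subst (f := fun x => (f x, g x)) (CE_Phi_app ar H))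
  | |- CE (fun x => @?f x = qf_conj (@?g x)) =>
      apply (CE_subst (f := fun x => (g x, f x)) CE_conj)
  | |- CE (fun x => @?f x = prime_enum (@?g x)) =>
      apply (CE_subst (f := fun x => (g x, f x)) CE_prime_enum)
  | |- CE (fun x => derivable eval_step (@?f x) (@?g x)) =>
      apply (CE_subst (f := fun x => (f x, g x)) (CE_derivable CE_eval_step))
  end.

Ltac ce ::= repeat first [ce_derived | ce_step | pr_constructor | ce_named].

(** * The four conditions *)

Section Equivalences.
Variables (ar : seq nat) (K : structure -> Prop).

Lemma Phi_app_substr Phi A B l : substr ar A B -> Phi_app ar Phi A l -> Phi_app ar Phi B l.
Proof. by move=> h [a [ha hP]]; exists a; split=> // m /ha; apply: D_substr. Qed.

(** The use principle: finitely many outputs draw on finitely many input literals, which together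
    live in one finite substructure. *)
Lemma Phi_app_finite Phi B (ls : seq literal) : (forall l, In' l ls -> Phi_app ar Phi B l) ->
  exists A : finstr, fin_wf ar A /\ substr ar (fs A) B /\
    forall l, In' l ls -> Phi_app ar Phi (fs A) l.
Proof.
move=> h.
have [a [ha hP]] : exists a, (forall m, In' m a -> D ar B m) /\
    forall l, In' l ls -> exists a', (forall m, In' m a' -> In' m a) /\ Phi (a', l).
  elim: ls h => [|l ls IH] h; first by exists [::].
  have [|a [ha hP]] := IH; first by move=> m hm; apply: h; right.
  have [a' [ha' hP']] := h l (or_introl erefl).
  exists (a' ++ a); split; first by move=> m /In'_cat [/ha'|/ha].
  move=> m [<-|/hP [b [hb hPb]]]; [exists a'|exists b]; split=> // k; rewrite In'_cat; auto.
have [A [wfA [AB hA]]] := finite_diagram ha; exists A; split=> //; split=> // l /hP [b [hb hPb]].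
by exists b; split=> // m /hb/hA.
Qed.

Lemma cond1_cond2 : cond1 ar K -> cond2 ar K.
Proof.
case=> Phi [[cPhi [_ hK]] hemb].
(* Holds by computation, the instance unfolding to the coding [code_trans_pair]. *)
have CPhi : CE Phi by [].
(* The finite structure need not lie in [K], so its image may be no diagram at all; monotonicity
   carries the witness to the images of its extensions in [K]. Primality is demanded because
   multiples of the characteristic admit witnesses too. *)
exists (fun z => fin_wf ar z.1 /\ prime z.2 /\ exists c s, char_witness (Phi_app ar Phi (fs z.1)) z.2 c s).
have key A n B F : fin_wf ar A /\ prime n /\ (exists c s, char_witness (Phi_app ar Phi (fs A)) n c s) ->
    substr ar (fs A) B -> PF F -> (forall l, Phi_app ar Phi B l <-> D ar_field F l) ->
    iso ar_field (Fp_struct n) F.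
  move=> [_ [pn [c [s hw]]]] AB [p [pp hF]] hD.
  suff -> : n = p by [].
  apply: (char_witness_unique pp pn hF) (char_witness_sub _ hw) => l _ hl.
  exact/hD/(Phi_app_substr AB).
split; last split; last split.
- refine (_ : @CE (finstr * nat) _ _).
  by rewrite /char_witness; ce.
- by move=> A n [].
- move=> B KB; have [F [[p [pp hF]] hD]] := hK B KB.
  have [c [s hw]] := char_witness_exists pp hF.
  have [l hl|A [wfA [AB hA]]] := @Phi_app_finite Phi B (char_literals p c s).
    exact/hD/(char_witness_literals hw).
  exists A, p; split=> //; split=> //; split=> //; exists c, s.
  by apply: char_witness_sub hw => l hl _; apply: hA.
- move=> A n A' n' B B' SA SA' KB KB' AB AB'.
  have [F [PF_F hD]] := hK B KB; have [F' [PF_F' hD']] := hK B' KB'.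
  have i1 := key _ _ _ _ SA AB PF_F hD; have i2 := key _ _ _ _ SA' AB' PF_F' hD'.
  rewrite (hemb B B' F F' KB KB' hD hD'); split=> [e|hi].
    by rewrite e in i1; apply: iso_trans (iso_sym i1) i2.
  have [pn pn'] : prime n /\ prime n' by case: SA SA' => _ [? _] [_ []].
  have [c [s hw]] := char_witness_exists pn i1.
  have i3 : iso ar_field (Fp_struct n') F by apply: iso_trans i2 (iso_sym hi).
  exact: char_witness_unique pn' pn i3 hw.
Qed.

(* The closure conditions force [T] to contain every tuple of elements of [A] of an arity in [ar],
   so that [ls] decides the diagram of [A] by bounded quantification only. *)
Definition describes (A : finstr) (ls : seq literal) (T : seq (seq nat)) (k : nat) : Prop :=
  (forall l, In' l ls -> D ar (fs A) l) /\
  (forall x, In' x (fdom A) -> x < k) /\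
  (forall x, In' x (fdom A) -> forall y, In' y (fdom A) -> x = y \/ In' (false, AEq x y) ls) /\
  In' [::] T /\
  (forall t, In' t T -> forall x, In' x (fdom A) -> sumn ar <= size t \/ In' (x :: t) T) /\
  (forall i, i < size ar -> forall t, In' t T ->
     size t <> nth 0 ar i \/ exists b, In' (b, ARel i t) ls).

(** The valuation is the embedding, sending [x] to [nth 0 v x]. The disequalities in [ls] make it
    injective, and on each tuple [ls] contains a literal that is true in [A] and, by the sentence,
    at the image in [B]. *)
Lemma describes_embeds A ls T k B v : describes A ls T k -> size v = k ->
  (forall x, In' x v -> sdom B x) -> holds_qf B v (qf_conj ls) ->
  exists B', iso ar B' B /\ substr ar (fs A) B'.
Proof.
case=> hD [hk [hne [hT0 [hTS hr]]]] sv hv /holds_conj hls.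
apply: (@embedding_substr ar A B (fun x => nth 0 v x)).
- by move=> x /In'P/hk hx; apply/hv/In'P/mem_nth; rewrite sv.
- move=> x y /In'P hx /In'P hy e; case: (hne x hx y hy) => // /hls /=; by case.
move=> i t [hi [ht hx]].
(* The tuple is built from the empty one by adding elements. Since [sumn ar] bounds every arity, the
   size escape in the closure condition is never taken on the way. *)
have tT : In' t T.
  have: size t <= sumn ar by rewrite ht leq_nth_sumn.
  elim: t {ht} hx => [|x t IH] hx //= hs.
  have tT : In' t T by apply: IH => [y hy|]; [apply: hx; right|exact: ltnW].
  have xA : In' x (fdom A) by apply/In'P; apply: hx; left.
  by case: (hTS t tT x xA) => //; rewrite leqNgt hs.
case: (hr i hi t tT) => [//|[b hb]].
have := hls _ hb; have [_] := hD _ hb; case: b {hb} => /=; by tauto.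
Qed.

Lemma describes_wf A ls T k : describes A ls T k -> wf_qf ar k (qf_conj ls).
Proof.
case=> hD [hk _]; elim: ls hD => //= -[b a] ls IH hD.
split; last by apply: IH => l hl; apply: hD; right.
have {hD} := hD _ (or_introl erefl); rewrite /qf_lit /=.
have -> (q : qf) : wf_qf ar k (if b then q else QNot q) = wf_qf ar k q by case: b.
case: a => [i t|x y]; rewrite /D /=.
  case=> -[hi [hs ht]] _; do !split=> //; apply/allP => x /In'P/ht hx.
  exact/hk/In'P.
by case=> /In'P/hk hx [/In'P/hk hy _].
Qed.

Lemma describes_exists A : fin_wf ar A -> exists ls T k,
  (describes A ls T k /\
      exists2 v, size v = k & forall B, substr ar (fs A) B ->
        (forall x, In' x v -> sdom B x) /\ holds_qf B v (qf_conj ls)).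
Proof.
move=> wfA; set d := fdom A.
(* The sum bounds every element, so [k] exceeds all of them. An empty structure must get no
   variables, since it may be a substructure of an empty one, where nothing could be assigned to
   them. *)
pose k := if d is [::] then 0 else (sumn d).+1.
have dk x : x \in d -> x < k.
  by move=> hx; move: (hx) (mem_leq_sumn hx); rewrite /k; case: (d).
have dhead : 0 < k -> head 0 d \in d by rewrite /k; case: (d) => // y s _; apply: mem_head.
pose T := flatten [seq tuples d m | m <- iota 0 (sumn ar).+1].
have memT t : t \in T <-> size t <= sumn ar /\ all (mem d) t.
  split=> [/flatten_mapP [m]|[h1 h2]].
    by rewrite mem_iota mem_tuples => hm /andP[/eqP -> ->].
  by apply/flatten_mapP; exists (size t); rewrite ?mem_iota ?mem_tuples ?eqxx.
pose L1 := [seq ((p.1 == p.2), AEq p.1 p.2) | p <- [seq (x, y) | x <- d, y <- d]] : seq literal.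
pose L2 := [seq (p \in ffacts A, ARel p.1 p.2) |
  p <- [seq (i, t) | i <- iota 0 (size ar), t <- tuples d (nth 0 ar i)]] : seq literal.
have hL1 l : In' l L1 <-> exists x y, [/\ x \in d, y \in d & l = (x == y, AEq x y)].
  rewrite In'_map; split=> [[p /In'P /allpairsP [[x y] /= [hx hy ->]] <-]|[x [y [hx hy ->]]]].
    by exists x, y.
  by exists (x, y) => //; apply/In'P/allpairsP; exists (x, y).
have hL2 l : In' l L2 <-> exists i t, [/\ i < size ar, size t = nth 0 ar i, all (mem d) t &
    l = ((i, t) \in ffacts A, ARel i t)].
  rewrite In'_map; split=> [[p /In'P /allpairsPdep [i [t [hi ht ->]]] <-]|[i [t [hi hs ht ->]]]].
    by move: hi ht; rewrite mem_iota mem_tuples => hi /andP[/eqP hs ht]; exists i, t.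
  exists (i, t) => //; apply/In'P/allpairsPdep; exists i, t.
  by rewrite mem_iota mem_tuples hs eqxx.
have hD l : In' l (L1 ++ L2) -> D ar (fs A) l.
  case/In'_cat => [/hL1 [x [y [hx hy ->]]]|/hL2 [i [t [hi hs ht ->]]]]; rewrite /D /=.
    by do !split=> //; case: eqP.
  split; last by case: ifP => // ->.
  by split=> //; split=> // x /In'P/(allP ht).
exists (L1 ++ L2), T, k; split.
- split=> //; split; first by move=> x /In'P/dk.
  split.
    move=> x /In'P hx y /In'P hy; case: (x =P y) => [->|/eqP ne]; [by left|right].
    by apply/In'_cat; left; apply/hL1; exists x, y; rewrite (negbTE ne).
  split; first exact/In'P/memT.
  split=> [t /In'P/memT [h1 h2] x /In'P hx|i hi t /In'P/memT [h1 h2]].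
    case: (leqP (sumn ar) (size t)) => hs; [by left|right].
    by apply/In'P/memT; rewrite /= hx.
  case: (size t =P nth 0 ar i) => hs; [right|by left].
  by exists ((i, t) \in ffacts A); apply/In'_cat; right; apply/hL2; exists i, t.
(* Elements name themselves; variables whose index is not an element receive the first element as a
   dummy value. *)
exists (mkseq (fun x => if x \in d then x else head 0 d) k); first exact: size_mkseq.
move=> B AB; have [AB1 AB2] := AB; split.
  move=> z /In'_map [x /In'P]; rewrite mem_iota => hx <-; apply: AB1; rewrite /= -/d.
  by case: ifP => // _; apply: dhead; apply: leq_ltn_trans hx.
apply/holds_conj => l /hD hl; move/(D_substr AB): (hl).
have nthE x : x \in d -> nth 0 (mkseq (fun x => if x \in d then x else head 0 d) k) x = x.
  by move=> hx; rewrite nth_mkseq ?dk // hx.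
case: l hl => b [i t|x y]; rewrite /D /qf_lit /=.
  case=> -[_ [_ ht]] _ [_].
  have e : [seq nth 0 (mkseq (fun x => if x \in d then x else head 0 d) k) j | j <- t] = t.
    by rewrite -[RHS]map_id; apply/eq_in_map => x /In'P/ht/nthE.
  by case: b => /=; rewrite e.
by case=> /nthE ex [/nthE ey _] [_ [_]]; case: b => /=; rewrite ex ey.
Qed.

Lemma cond2_cond3 : iso_closed ar K -> cond2 ar K -> cond3 ar K.
Proof.
move=> HK [S [cS [wfS [Sex Siff]]]].
have CS : CE S by [].
exists (fun z : exsent * nat => exists A ls T, S (A, z.2) /\
  describes A ls T (nvars z.1) /\ matrix z.1 = qf_conj ls).
split; last split; last split.
- refine (_ : @CE (exsent * nat) _ _).
  by rewrite /describes; ce.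
- by move=> e n [A [ls [T [_ [/describes_wf h e1]]]]]; rewrite /wf_ex e1.
- move=> B /Sex [A [n [hS AB]]].
  have [ls [T [k [hd [v sv hv]]]]] := describes_exists (wfS _ _ hS).
  have [hv1 hv2] := hv B AB.
  exists (ExSent k (qf_conj ls)), n; split; first by exists A, ls, T.
  by exists v.
move=> e n e' n' B B' [A [ls [T [hS [hd he]]]]] [A' [ls' [T' [hS' [hd' he']]]]] KB KB'.
case=> v [sv [hv hm]] [v' [sv' [hv' hm']]].
rewrite he in hm; rewrite he' in hm'.
have [C [iC AC]] := describes_embeds hd sv hv hm.
have [C' [iC' AC']] := describes_embeds hd' sv' hv' hm'.
(* Satisfying the sentence only gives a copy of [A] inside [B]. Closure under isomorphism puts the
   structures [C] and [C'], which contain [A] and [A'] literally, into [K], where the hypothesis on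
   [S] applies. *)
have KC := HK _ _ (iso_sym iC) KB; have KC' := HK _ _ (iso_sym iC') KB'.
rewrite (Siff _ _ _ _ C C' hS hS' KC KC' AC AC'); split=> i.
  exact: iso_trans (iso_sym iC) (iso_trans i iC').
exact: iso_trans iC (iso_trans i (iso_sym iC')).
Qed.

(** The first clause restricts inputs to parts of diagrams of finite structures, as a transformation
    requires. The literals [x = x] certify that the valuation takes its values in the universe. *)
Definition prime_field_trans (S : exsent * nat -> Prop) (z : seq literal * literal) : Prop :=
  (exists A : finstr, fin_wf ar A /\ forall l, In' l z.1 -> D ar (fs A) l) /\
  exists e n v p, S (e, n) /\ size v = nvars e /\
    (forall x, In' x v -> In' (true, AEq x x) z.1) /\
    derivable eval_step (z.1, v) (true, matrix e) /\
    p = prime_enum n /\ D ar_field (Fp_struct p) z.2.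

Lemma cond3_cond1 : cond3 ar K -> cond1 ar K.
Proof.
case=> S [cS [wfS [Sex Siff]]].
have CS : CE S by [].
exists (prime_field_trans S).
have sat B alpha e v : (forall l, In' l alpha -> D ar B l) -> size v = nvars e ->
    (forall x, In' x v -> In' (true, AEq x x) alpha) ->
    derivable eval_step (alpha, v) (true, matrix e) -> sat_ex B e.
  move=> ha sv hv he; exists v; split=> //; split; first by move=> x /hv/ha [].
  exact: (eval_sound ha he).
have compl B e n : S (e, n) -> sat_ex B e -> exists alpha v,
    [/\ forall l, In' l alpha -> D ar B l, size v = nvars e,
        forall x, In' x v -> In' (true, AEq x x) alpha &
        derivable eval_step (alpha, v) (true, matrix e)].
  move=> hS [v [sv [hv hm]]].
  have [|a [b [ha hb]]] := @eval_complete ar B v (matrix e) hv; first by rewrite sv; apply: wfS hS.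
  (* The forced value is true: by soundness, forcing false would contradict the satisfaction of the
     matrix. *)
  have {}hb : derivable eval_step (a, v) (true, matrix e).
    by case: b hb => // /(eval_sound ha).
  exists (a ++ [seq (true, AEq x x) | x <- v]), v; split=> //.
  - by move=> l /In'_cat [/ha //|/In'_map [x /hv hx <-]].
  - by move=> x hx; apply/In'_cat; right; apply/In'_map; exists x.
  - by apply: eval_mono hb => l hl; apply/In'_cat; left.
(* All sentences of [S] true in [B] carry the same index, as [B] is isomorphic to itself. Hence
   outputs triggered by different sentences never mix two fields. *)
have app B e n : K B -> S (e, n) -> sat_ex B e -> forall l,
    Phi_app ar (prime_field_trans S) B l <-> D ar_field (Fp_struct (prime_enum n)) l.
  move=> KB hS hB l; split.
    case=> alpha [ha [_ [e' [n' [v [p [hS' [sv [hv [he [-> hl]]]]]]]]]]].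
    suff -> : n = n' by [].
    by apply/(Siff _ _ _ _ B B hS hS') => //; [apply: sat he|apply: iso_refl].
  move=> hl; have [alpha [v [ha sv hv he]]] := compl _ _ _ hS hB.
  exists alpha; split=> //; split.
    by have [A [wfA [_ hA]]] := finite_diagram ha; exists A.
  by exists e, n, v, (prime_enum n).
split; first split.
- refine (_ : @CE (seq literal * literal) _ _).
  by rewrite /prime_field_trans; ce.
- split.
    move=> alpha l [[A [wfA hA]] [e [n [v [p [_ [_ [_ [_ [_ hl]]]]]]]]]].
    by split; [exists A|apply: D_wf hl].
  move=> B KB; have [e [n [hS hB]]] := Sex B KB.
  exists (Fp_struct (prime_enum n)); split; last exact: app hS hB.
  by exists (prime_enum n); split; [apply: prime_enum_prime|apply: iso_refl].
move=> B B' F F' KB KB' hF hF'.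
have [e [n [hS hB]]] := Sex B KB; have [e' [n' [hS' hB']]] := Sex B' KB'.
have i1 : iso ar_field (Fp_struct (prime_enum n)) F.
  by apply: iso_of_D => l; rewrite -(app _ _ _ KB hS hB) hF.
have i2 : iso ar_field (Fp_struct (prime_enum n')) F'.
  by apply: iso_of_D => l; rewrite -(app _ _ _ KB' hS' hB') hF'.
rewrite -(Siff _ _ _ _ B B' hS hS' KB KB' hB hB'); split=> [e0|hi].
  by rewrite -e0 in i2; apply: iso_trans (iso_sym i1) i2.
(* Isomorphic fields admit the same characteristic, so the two primes coincide, and injectivity of
   the enumeration returns equal indices. *)
have i3 := iso_trans i1 (iso_trans hi (iso_sym i2)).
have [c [s hw]] := char_witness_exists (prime_enum_prime n') (iso_refl _ _).
apply/prime_enum_inj/esym.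
exact: char_witness_unique (prime_enum_prime n) (prime_enum_prime n') i3 hw.
Qed.

Lemma cond3_cond4 : cond3 ar K <-> cond4 ar K.
Proof.
split=> [[S [cS [wfS [Sex Siff]]]]|[W [cW [wfW [Wex Wiff]]]]].
  exists (fun n e => S (e, n)); split.
    by apply/ce_familyE; apply: (@CE_ext _ _ S) => [[e n]|].
  split; first by move=> n e; apply: wfS.
  split; first by move=> B /Sex [e [n [h1 h2]]]; exists n, e.
  move=> n n' B B' KB KB' [e [h1 h2]] [e' [h1' h2']].
  by rewrite (Siff _ _ _ _ B B' h1 h1').
exists (fun z => W z.2 z.1); split; first exact/ce_familyE.
split; first by move=> e n; apply: wfW.
split; first by move=> B /Wex [n [e [h1 h2]]]; exists e, n.
move=> e n e' n' B B' h1 h1' KB KB' h2 h2'.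
by rewrite (Wiff n n' B B') //; [exists e|exists e'].
Qed.
End Equivalences.

Theorem theorem3p4 (ar : seq nat) (K : structure -> Prop) (HK : iso_closed ar K) :
  (cond1 ar K <-> cond2 ar K) /\ (cond1 ar K <-> cond3 ar K) /\ (cond1 ar K <-> cond4 ar K).
Proof.
have h12 := @cond1_cond2 ar K; have h23 := cond2_cond3 HK.
have h31 := @cond3_cond1 ar K; have h34 := @cond3_cond4 ar K.
tauto.
Qed.
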